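(* Let $K$ and $L$ be uncountable compact metrizable spaces. Then there is a positive isomorphism $T:C(K)\longrightarrow C(L)$ whose inverse $T^{-1}$ is a regular operator; in fact, $T$ may be chosen so that \[ \|T\|\leq \sqrt{9+6\sqrt3} \qquad\text{and}\qquad \|T^{-1}\|_{\mathrm r}\leq \sqrt{9+6\sqrt3}. \]
   Context: All Banach lattices are real. $C(K)$ denotes the Banach lattice of real-valued continuous functions on the compact Hausdorff space $K$, with the supremum norm and pointwise order. An operator $S$ between Banach lattices is positive ($S\ge 0$) if $Sx\ge 0$ whenever $x\ge 0$. A positive isomorphism is a linear isomorphism (bounded linear bijection with bounded inverse) $T$ which is a positive operator; its inverse is not required to be positive. An operator $S$ between Banach lattices is regular if it is the difference of two positive operators; its regular norm is \[ \|S\|_{\mathrm r}=\inf\{\|R\| : R\ge 0,\ -R\le S\le R\}, \] where $A\le B$ for operators means $B-A\ge 0$. *)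

(* Defs.v *)
From HB Require Import structures.
From mathcomp Require Import all_boot all_order all_algebra.
From mathcomp Require Import all_classical all_reals all_analysis.

Set Implicit Arguments.
Unset Strict Implicit.
Unset Printing Implicit Defensive.

Import Order.TTheory GRing.Theory Num.Theory.
Import numFieldNormedType.Exports.

Local Open Scope classical_set_scope.
Local Open Scope ring_scope.

HB.mixin Record isCompactHausdorff K & Topological K := {
  compact_setT : compact [set: K] ;
  hausdorff_setT : hausdorff_space K }.

#[short(type="compactHausdorffType")]
HB.structure Definition CompactHausdorff :=
  {K of Topological K & isCompactHausdorff K}.

Definition is_metric {R : realType} {T : Type} (d : T -> T -> R) : Prop :=
  [/\ forall x y, 0 <= d x y,
      forall x y, d x y = 0 <-> x = y,
      forall x y, d x y = d y x &
      forall x y z, d x z <= d x y + d y z].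

Definition metrizable (R : realType) (T : topologicalType) : Prop :=
  exists2 d : T -> T -> R, is_metric d &
    forall x : T, nbhs x = nbhs_ball_ (fun y e => [set z | d y z < e]) x.

(* An alias, because the library puts the pointwise topology on
   [continuousType K R] when [ArrowAsProduct] is imported. *)
Definition cfun (R : realType) (K : topologicalType) : Type :=
  continuousType K R.

HB.instance Definition _ (R : realType) (K : topologicalType) :=
  Choice.on (cfun R K).

Notation "''C(' K , R )" := (cfun R K) (at level 8, format "''C(' K ,  R )").

Section algebra.
Context {R : realType} {K : topologicalType}.
Implicit Types f g h : 'C(K, R).

Definition cfun_mk (f : K -> R) (cf : continuous f) : 'C(K, R) :=
  (mkcts cf : continuousType K R).

Lemma cfun_continuous f : continuous f.
Proof. exact: (@cts_fun _ _ (f : continuousType K R)). Qed.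

Lemma cfunP f g : (forall x, f x = g x) -> f = g.
Proof. by move=> fg; apply/continuousEP. Qed.

Definition cfun0 : 'C(K, R) := cfun_mk (@cst_continuous K R 0).

Definition cfunN f : 'C(K, R) :=
  cfun_mk (fun x => continuousN (@cfun_continuous f x)).

Definition cfunD f g : 'C(K, R) :=
  cfun_mk (fun x => continuousD (@cfun_continuous f x) (@cfun_continuous g x)).

Definition cfunZ (a : R) f : 'C(K, R) :=
  cfun_mk (fun x => continuousM (@cst_continuous K R a x)
                                (@cfun_continuous f x)).

Let addA : associative cfunD.
Proof. by move=> f g h; apply: cfunP => x; exact: addrA. Qed.
Let addC : commutative cfunD.
Proof. by move=> f g; apply: cfunP => x; exact: addrC. Qed.
Let add0 : left_id cfun0 cfunD.
Proof. by move=> f; apply: cfunP => x; exact: add0r. Qed.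
Let addN : left_inverse cfun0 cfunN cfunD.
Proof. by move=> f; apply: cfunP => x; exact: addNr. Qed.

HB.instance Definition _ :=
  GRing.isZmodule.Build 'C(K, R) addA addC add0 addN.

Let scaleA a b f : cfunZ a (cfunZ b f) = cfunZ (a * b) f.
Proof. by apply: cfunP => x; exact: mulrA. Qed.
Let scale1 : left_id 1 cfunZ.
Proof. by move=> f; apply: cfunP => x; exact: mul1r. Qed.
Let scaleDr : right_distributive cfunZ +%R.
Proof. by move=> a f g; apply: cfunP => x; exact: mulrDr. Qed.
Let scaleDl f : {morph cfunZ^~ f : a b / a + b}.
Proof. by move=> a b; apply: cfunP => x; exact: mulrDl. Qed.

HB.instance Definition _ :=
  GRing.Zmodule_isLmodule.Build R 'C(K, R) scaleA scale1 scaleDr scaleDl.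

Lemma cfun0E x : (0 : 'C(K, R)) x = 0. Proof. by []. Qed.
Lemma cfunNE f x : (- f) x = - f x. Proof. by []. Qed.
Lemma cfunDE f g x : (f + g) x = f x + g x. Proof. by []. Qed.
Lemma cfunZE (a : R) f x : (a *: f) x = a * f x. Proof. by []. Qed.

Definition cfun_le f g : bool := `[< forall x, f x <= g x >].

Let le_refl : reflexive cfun_le.
Proof. by move=> f; apply/asboolP. Qed.
Let le_anti : antisymmetric cfun_le.
Proof.
move=> f g /andP[/asboolP fg /asboolP gf]; apply: cfunP => x.
by apply/eqP; rewrite eq_le fg gf.
Qed.
Let le_trans : transitive cfun_le.
Proof.
move=> g f h /asboolP fg /asboolP gh; apply/asboolP => x.
exact: Order.POrderTheory.le_trans (fg x) (gh x).
Qed.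

HB.instance Definition _ :=
  Order.Le_isPOrder.Build ring_display 'C(K, R) le_refl le_anti le_trans.

Lemma cfun_leP f g : reflect (forall x, f x <= g x) (f <= g).
Proof. exact: asboolP. Qed.

End algebra.

(* For empty [K] the supremum below is [sup set0 = 0]. *)
Definition cfun_norm {R : realType} {K : topologicalType} (f : 'C(K, R)) : R :=
  sup (range (fun x => `|f x|)).

Section norm.
Context {R : realType} {K : compactHausdorffType}.
Implicit Types f g : 'C(K, R).

Lemma cfun_has_ubound f : has_ubound (range (fun x => `|f x|)).
Proof.
have cf : {within [set: K], continuous (fun x => `|f x|)}.
  apply: continuous_subspaceT => x.
  apply: continuous_comp; first exact: cfun_continuous.
  exact: norm_continuous.
have /compact_bounded[M [_ fM]] := continuous_compact cf compact_setT.
exists (M + 1) => _ [x _ <-]; have := fM (M + 1).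
rewrite ltrDl ltr01 => /(_ isT `|f x|) /=; rewrite normr_id; apply.
by exists x.
Qed.

Lemma cfun_norm_ub f x : `|f x| <= cfun_norm f.
Proof. by apply: ub_le_sup; [exact: cfun_has_ubound|exists x]. Qed.

Lemma cfun_norm_ge0 f : 0 <= cfun_norm f.
Proof.
rewrite /cfun_norm; have [->|/set0P[_ [x _ _]]] :=
  eqVneq (range (fun x => `|f x|)) set0; first by rewrite sup0.
by apply: Order.POrderTheory.le_trans (cfun_norm_ub f x).
Qed.

Lemma cfun_norm_le f (M : R) :
  0 <= M -> (forall x, `|f x| <= M) -> cfun_norm f <= M.
Proof.
move=> M0 fM; rewrite /cfun_norm; have [->|/set0P ne] :=
  eqVneq (range (fun x => `|f x|)) set0; first by rewrite sup0.
by apply: ge_sup => // _ [x _ <-].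
Qed.

Let normD f g : cfun_norm (f + g) <= cfun_norm f + cfun_norm g.
Proof.
apply: cfun_norm_le => [|x]; first by rewrite addr_ge0 ?cfun_norm_ge0.
by rewrite cfunDE (Order.POrderTheory.le_trans (ler_normD _ _))// lerD
  ?cfun_norm_ub.
Qed.

Let normZle (a : R) f : cfun_norm (a *: f) <= `|a| * cfun_norm f.
Proof.
apply: cfun_norm_le => [|x]; first by rewrite mulr_ge0 ?cfun_norm_ge0.
by rewrite cfunZE normrM ler_wpM2l ?cfun_norm_ub.
Qed.

Let normZ (a : R) f : cfun_norm (a *: f) = `|a| * cfun_norm f.
Proof.
have [->|a0] := eqVneq a 0.
  apply/eqP; rewrite normr0 mul0r eq_le cfun_norm_ge0 andbT.
  by rewrite (Order.POrderTheory.le_trans (normZle _ _))// normr0 mul0r.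
apply/eqP; rewrite eq_le normZle/= -ler_pdivlMl ?normr_gt0// -normfV.
by rewrite -{1}[f]scale1r -(mulVf a0) -scalerA normZle.
Qed.

Let norm0 f : cfun_norm f = 0 -> f = 0.
Proof.
move=> f0; apply: cfunP => x; apply/normr0_eq0/eqP.
by rewrite eq_le normr_ge0 andbT -f0 cfun_norm_ub.
Qed.

HB.instance Definition _ :=
  Lmodule_isNormed.Build R 'C(K, R) normD normZ norm0.

End norm.

Section operators.
Context {R : realType} {K L : compactHausdorffType}.

Definition bounded_op (S : {linear 'C(K, R) -> 'C(L, R)}) : Prop :=
  bounded_near S (nbhs (0 : 'C(K, R))).

Definition positive_op (S : 'C(K, R) -> 'C(L, R)) : Prop :=
  forall f : 'C(K, R), 0 <= f -> 0 <= S f.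

Definition op_le (A B : 'C(K, R) -> 'C(L, R)) : Prop := positive_op (B \- A).

Definition regular_op (S : {linear 'C(K, R) -> 'C(L, R)}) : Prop :=
  exists A B : {linear 'C(K, R) -> 'C(L, R)},
    [/\ bounded_op A, bounded_op B, positive_op A, positive_op B &
        forall f, S f = A f - B f].

Definition opnorm (S : {linear 'C(K, R) -> 'C(L, R)}) : \bar R :=
  ereal_sup [set `|S f|%:E | f in [set f : 'C(K, R) | `|f| <= 1]].

(* Extended-real valued: [+oo] when no positive operator dominates [S]. *)
Definition regular_norm (S : {linear 'C(K, R) -> 'C(L, R)}) : \bar R :=
  ereal_inf [set opnorm P | P in [set P : {linear 'C(K, R) -> 'C(L, R)} |
    [/\ bounded_op P, positive_op P, op_le (\- P) S & op_le S P]]].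

End operators.

Section isomorphisms.
Context {R : realType} {K L : compactHausdorffType}.
Variables (T : {linear 'C(K, R) -> 'C(L, R)}).
Variables (Tinv : {linear 'C(L, R) -> 'C(K, R)}).

Definition isomorphism_with_inverse : Prop :=
  [/\ cancel T Tinv, cancel Tinv T, bounded_op T & bounded_op Tinv].

Definition positive_isomorphism_with_inverse : Prop :=
  isomorphism_with_inverse /\ positive_op T.

End isomorphisms.

(* Main.v *)
(* Let X = C(K), W = C(L), and write c(W) for the convergent sequences in W,
   that is, C(L x {0, 1, ..., oo}).  As K contains a Cantor set, there are
   positive unital maps J : c(W) -> X and P : X -> c(W) with P J = 1: points of K
   and of L x {0, 1, ..., oo} are both assigned probability measures on the
   boundary of the binary tree, and J and P integrate against them.  Likewise
   there are J' : c(X) -> W and P' : W -> c(X).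

   Let S be the left shift and q > 1.  On c(W), the operator 1 + q S is positive,
   onto, and its kernel, made of the sequences ((-1/q)^n x), is a copy of W; hence
   f |-> (P_0 f, f + q J S P f) is a positive isomorphism X -> W (+) X.  On c(X),
   the operator q + S is positive and invertible, so that
   (x, h) |-> x + q J' (h, P' x) is a positive isomorphism W (+) X -> W.  Composing
   the two gives T, once the parameter of each factor and the scale of h are chosen
   optimally.  The inverse is computed by recursions with alternating signs;
   making all signs positive gives an operator that dominates it, so its regular
   norm is bounded by the value of that operator at 1. *)

Require Import Defs.
From mathcomp Require Import all_boot all_order all_algebra.
From mathcomp Require Import all_classical all_reals all_analysis.
From HB Require Import structures.
From mathcomp Require Import ring lra.

Set Implicit Arguments.
Unset Strict Implicit.
Unset Printing Implicit Defensive.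

Import Order.TTheory GRing.Theory Num.Theory.
Import numFieldNormedType.Exports.

Local Open Scope classical_set_scope.
Local Open Scope ring_scope.

(** * Limits of real sequences *)

Section limits.
Context {R : realType}.
Implicit Types (u v : nat -> R) (a e : R).

Definition near_stable u := forall e, 0 < e -> exists N, forall n, `|u (n + N)%N - u N| <= e.

Lemma near_stable_cvg u : near_stable u -> cvgn u.
Proof.
move=> su; apply/cauchy_cvgP/cauchy_exP => e e0.
have e20 : 0 < e / 2 by lra.
have [N uN] := su _ e20; exists (u N), N => // n /= Nn.
rewrite /ball /= distrC -(subnK Nn); apply: le_lt_trans (uN _) _; lra.
Qed.

Lemma limn_near u a e N : cvgn u -> (forall n, `|u (n + N)%N - a| <= e) -> `|limn u - a| <= e.
Proof.
move=> cu uN.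
have cd : (fun n => `|u n - a|) @ \oo --> `|limn u - a|.
  by apply: cvg_norm; apply: cvgB => //; exact: cvg_cst.
rewrite -(cvg_lim _ cd)//; apply: limr_le; first by apply/cvg_ex; exists `|limn u - a|.
by exists N => // n /= Nn; rewrite -(subnK Nn).
Qed.

Lemma cvgn_cst a : cvgn (fun=> a : R).
Proof. by apply/cvg_ex; exists a; exact: cvg_cst. Qed.

Lemma cvgn_lin a u v : cvgn u -> cvgn v -> cvgn (fun n => a * u n + v n).
Proof.
by move=> cu cv; apply: is_cvgD => //; apply: is_cvgM => //; exact: cvgn_cst.
Qed.

Lemma limn_lin a u v : cvgn u -> cvgn v -> limn (fun n => a * u n + v n) = a * limn u + limn v.
Proof.
move=> cu cv; apply: cvg_lim => //; apply: cvgD => //; apply: cvgM => //; exact: cvg_cst.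
Qed.

Lemma eq0_small a : (forall e, 0 < e -> `|a| <= e) -> a = 0.
Proof.
move=> ae; apply/eqP; rewrite -normr_le0; apply/ler_addgt0Pr => e e0.
by rewrite add0r ae.
Qed.

End limits.

(** * Averages over the binary tree *)

Section tree.
Context {R : realType}.
Implicit Types (u w : seq bool -> R) (s t : seq bool) (n m : nat) (c e : R).

(* Words are read from right to left: [b :: s] is a child of [s].  This is the mean
   of [w] over the descendants of [s] of relative depth [n] when the mass at a node
   [t] is split in the proportions [u t] and [1 - u t]. *)
Fixpoint tavg n u w s : R :=
  if n is n'.+1 then
    u s * tavg n' u w (true :: s) + (1 - u s) * tavg n' u w (false :: s)
  else w s.

Definition splitting u := forall s, 0 <= u s <= 1.

(** The nodes of positive mass for the measure on the boundary of the tree given by the splitting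
    [u]. *)
Fixpoint charged u s : bool :=
  if s is b :: s' then charged u s' && (if b then 0 < u s' else u s' < 1)
  else true.

(** A child that receives no mass disappears from the average, so the bound is only needed at
    charged descendants. This is what later allows values at uncharged nodes to be arbitrary. *)
Lemma tavg_near n u w s c e : splitting u -> charged u s -> 0 <= e ->
  (forall t, size t = n -> charged u (t ++ s) -> `|w (t ++ s) - c| <= e) ->
  `|tavg n u w s - c| <= e.
Proof.
move=> u01 + e0; elim: n s => [|n IH] s cs wc /=; first exact: (wc [::]).
have step b : (if b then 0 < u s else u s < 1) -> `|tavg n u w (b :: s) - c| <= e.
  move=> ub; apply: IH => /=; first by rewrite cs ub.
  by move=> t st; rewrite -cat_rcons; apply: wc; rewrite size_rcons st.
have /andP[u0 u1] := u01 s.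
have [ueq0|un0] := eqVneq (u s) 0.
  by have := step false; rewrite ueq0 ltr01 => /(_ isT); rewrite mul0r add0r subr0 mul1r.
have [ueq1|un1] := eqVneq (u s) 1.
  by have := step true; rewrite ueq1 ltr01 => /(_ isT); rewrite subrr mul0r addr0 mul1r.
have xt : `|tavg n u w (true :: s) - c| <= e by apply: step; rewrite lt_def un0.
have xf : `|tavg n u w (false :: s) - c| <= e.
  by apply: step; rewrite lt_def eq_sym un1.
move: xt xf; set x := tavg _ _ _ _; set y := tavg _ _ _ _.
by move=> /ler_normlP[x1 x2] /ler_normlP[y1 y2]; apply/ler_normlP; split; nra.
Qed.

Lemma tavg_lin n u w w' a s :
  tavg n u (fun t => a * w t + w' t) s = a * tavg n u w s + tavg n u w' s.
Proof. by elim: n s => [//|n IH] s /=; rewrite !IH; ring. Qed.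

Lemma tavg_ge0 n u w s :
  splitting u -> (forall t, 0 <= w t) -> 0 <= tavg n u w s.
Proof.
move=> u01 w0; elim: n s => [//|n IH] s /=; have /andP[u0 u1] := u01 s.
by rewrite addr_ge0 ?mulr_ge0 ?subr_ge0 ?IH.
Qed.

Lemma tavg_cst n u c s : tavg n u (fun=> c) s = c.
Proof. by elim: n s => [//|n IH] s /=; rewrite !IH; ring. Qed.

Lemma tavg_comp m n u w s : tavg n u (tavg m u w) s = tavg (n + m) u w s.
Proof. by elim: n s => [//|n IH] s /=; rewrite !IH. Qed.

Definition tree_osc w N e :=
  forall t s, (N <= size s)%N -> `|w (t ++ s) - w s| <= e.

(** Such a [w] stands for a continuous function on the boundary of the tree, namely its uniform
    limit along branches. *)
Definition tree_cauchy w := forall e, 0 < e -> exists N, tree_osc w N e.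

Lemma tavg_osc m n u w e : splitting u -> 0 <= e -> tree_osc w n e ->
  `|tavg (m + n) u w [::] - tavg n u w [::]| <= e.
Proof.
move=> u01 e0 we; rewrite addnC -tavg_comp.
have -> : tavg n u (tavg m u w) [::] - tavg n u w [::] =
    tavg n u (fun t => -1 * w t + tavg m u w t) [::] by rewrite tavg_lin; ring.
rewrite -[X in `|X|]subr0; apply: tavg_near => // t tn; rewrite cats0 => ct.
rewrite subr0 mulN1r addrC; apply: tavg_near => // t' _ _.
by apply: we; rewrite tn.
Qed.

(** The integral of the boundary function of [w] against the probability measure of [u]. *)
Definition tlim u w := limn (fun n => tavg n u w [::]).

Lemma tavg_stable u w : splitting u -> tree_cauchy w ->
  near_stable (fun n => tavg n u w [::]).
Proof.
move=> u01 cw e e0; have [N wN] := cw _ e0; exists N => n.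
by apply: tavg_osc => //; exact: ltW.
Qed.

Lemma tlim_osc N u w e : splitting u -> tree_cauchy w -> 0 <= e ->
  tree_osc w N e -> `|tlim u w - tavg N u w [::]| <= e.
Proof.
move=> u01 cw e0 wN; apply: (limn_near (N := N)).
  exact/near_stable_cvg/tavg_stable.
by move=> n; apply: tavg_osc.
Qed.

Lemma tlim_near N u w c e : splitting u -> tree_cauchy w -> 0 <= e ->
  (forall t, (N <= size t)%N -> charged u t -> `|w t - c| <= e) ->
  `|tlim u w - c| <= e.
Proof.
move=> u01 cw e0 wN; apply: (limn_near (N := N)).
  exact/near_stable_cvg/tavg_stable.
move=> n; apply: tavg_near => // t tn; rewrite cats0; apply: wN.
by rewrite tn leq_addl.
Qed.

Lemma tlim_lin u w w' a : splitting u -> tree_cauchy w -> tree_cauchy w' ->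
  tlim u (fun t => a * w t + w' t) = a * tlim u w + tlim u w'.
Proof.
move=> u01 cw cw'; rewrite /tlim -limn_lin; last 2 first.
- exact/near_stable_cvg/tavg_stable.
- exact/near_stable_cvg/tavg_stable.
by congr (limn _); apply/funext => n; rewrite tavg_lin.
Qed.

Lemma tlim_ge0 u w : splitting u -> tree_cauchy w -> (forall t, 0 <= w t) ->
  0 <= tlim u w.
Proof.
move=> u01 cw w0; apply: limr_ge; first exact/near_stable_cvg/tavg_stable.
by near=> n; apply: tavg_ge0.
Unshelve. all: end_near. Qed.

Lemma tlim_cst u c : tlim u (fun=> c) = c.
Proof.
rewrite /tlim (_ : (fun n => _) = fun=> c) ?lim_cst//.
by apply/funext => n; rewrite tavg_cst.
Qed.

Lemma tavg_continuous (X : topologicalType) n (u : X -> seq bool -> R) w s :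
  (forall t, continuous (u^~ t)) -> continuous (fun x => tavg n (u x) w s).
Proof.
move=> cu; elim: n s => [|n IH] s x /=; first exact: cst_continuous.
apply: cvgD; first by apply: cvgM; [exact: cu|exact: IH].
apply: cvgM; last exact: IH.
by apply: cvgB; [exact: cst_continuous|exact: cu].
Qed.

Lemma uniform_approx_continuous (X : topologicalType) (F : X -> R) :
  (forall e, 0 < e -> exists2 G : X -> R, continuous G & forall x, `|F x - G x| <= e) ->
  continuous F.
Proof.
move=> FG x; apply/cvgrPdist_le => e e0.
have e3 : 0 < e / 3 by rewrite divr_gt0.
have [G cG GF] := FG _ e3.
have /cvgrPdist_le/(_ _ e3) := cG x.
apply: filterS => y Gy.
have /ler_normlP[a1 a2] := GF x; have /ler_normlP[b1 b2] := GF y.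
by move/ler_normlP: Gy => [c1 c2]; apply/ler_normlP; split; lra.
Qed.

Lemma tlim_continuous (X : topologicalType) (u : X -> seq bool -> R) w :
  (forall x, splitting (u x)) -> (forall t, continuous (u^~ t)) ->
  tree_cauchy w -> continuous (fun x => tlim (u x) w).
Proof.
move=> u01 cu cw; apply: uniform_approx_continuous => e e0.
have [N wN] := cw _ e0.
exists (fun x => tavg N (u x) w [::]); first exact: tavg_continuous.
by move=> x; apply: tlim_osc => //; exact: ltW.
Qed.

End tree.

(** * Compact metric spaces *)

Section metric.
Context {R : realType} {K : compactHausdorffType} (d : K -> K -> R).
Hypothesis dm : is_metric d.
Hypothesis dn : forall x : K, nbhs x = nbhs_ball_ (fun y e => [set z | d y z < e]) x.

Let dge0 x y : 0 <= d x y. Proof. by case: dm. Qed.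
Let dC x y : d x y = d y x. Proof. by case: dm. Qed.
Let dtri x y z : d x z <= d x y + d y z. Proof. by case: dm. Qed.

Lemma dist_nbhs x r : 0 < r -> \forall y \near x, d x y < r.
Proof. by move=> r0; suff : nbhs x [set y | d x y < r] by []; rewrite dn; exists r. Qed.

Lemma finite_ball_cover (r : K -> R) : (forall x, 0 < r x) ->
  exists s : seq K, forall y, exists2 x, x \in s & d x y < r x.
Proof.
move=> r0.
(* Finite lists directed by inclusion: what holds near each point for all large lists holds, by
   compactness, everywhere for one list. *)
pose F : set_system (seq K) := filter_from [set: seq K]
  (fun s0 : seq K => [set s : seq K | {subset s0 <= s}]).
have FF : Filter F.
  apply: filter_from_filter; first by exists [::].
  move=> s t _ _; exists (s ++ t) => // u /= stu.
  by split=> x xs; apply: stu; rewrite mem_cat xs ?orbT.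
have /compact_near_coveringP cK := @compact_setT K.
have := cK _ F (fun s y => exists2 x, x \in s & d x y < r x) FF.
case=> [x _|s _ sF]; last by exists s => y; exact: (sF s).
exists ([set y | d x y < r x], [set s : seq K | x \in s]) => /=.
  split; first exact: dist_nbhs.
  by exists [:: x] => // s /= /(_ x); rewrite inE eqxx; exact.
by move=> [y s] /= [xy xs]; exists x.
Qed.

Lemma dist_uniform_continuity (f : 'C(K, R)) e : 0 < e ->
  exists2 r, 0 < r & forall x y, d x y < r -> `|f x - f y| <= e.
Proof.
move=> e0; have e2 : 0 < e / 2 by rewrite divr_gt0.
(* The modulus at [x] is taken as [r + r]: a point within [r] of [x], and any point within the least
   chosen radius of that one, both fall in its range. *)
have /choice[r rP] : forall x, exists r,
    0 < r /\ forall y, d x y < r + r -> `|f x - f y| <= e / 2.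
  move=> x; have /cvgrPdist_le/(_ _ e2) := @cfun_continuous _ _ f x.
  rewrite /prop_near1 nbhs_simpl/= dn => -[r /= r0 rf]; exists (r / 2); split; first by rewrite divr_gt0.
  by move=> y; rewrite -splitr; apply: rf.
have [s sP] := finite_ball_cover (fun x => (rP x).1).
have [r0 r00 r0s] : exists2 r0, 0 < r0 & forall x, x \in s -> r0 <= r x.
  elim: s {sP} => [|x s [r1 r10 r1s]]; first by exists 1.
  exists (Num.min (r x) r1); first by rewrite lt_min r10 andbT; case: (rP x).
  move=> y; rewrite inE => /predU1P[->|/r1s yr]; first by rewrite ge_min lexx.
  by rewrite ge_min yr orbT.
exists r0 => //.
move=> x y xy; have [z zs zx] := sP x.
have zy : d z y < r z + r z.
  apply: le_lt_trans (dtri z x y) _; rewrite ltrD//.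
  exact: lt_le_trans xy (r0s _ zs).
have zx' : d z x < r z + r z by apply: (lt_trans zx); rewrite ltrDl; case: (rP z).
have /ler_normlP[a1 a2] := (rP z).2 _ zy; have /ler_normlP[b1 b2] := (rP z).2 _ zx'.
by apply/ler_normlP; split; lra.
Qed.

Lemma dist_net r : 0 < r -> exists s : seq K, forall y, exists2 x, x \in s & d x y < r.
Proof. by move=> r0; exact: (@finite_ball_cover (fun=> r)). Qed.

Lemma dist_continuous x : continuous (d x).
Proof.
move=> y; apply/cvgrPdist_le => e e0.
have := dist_nbhs y e0; apply: filterS => z yz.
have := dtri x y z; have := dtri x z y; rewrite (dC z y) => h1 h2.
by apply/ler_normlP; split; lra.
Qed.

Definition plateau x r y : R := Num.max 0 (Num.min 1 (2 - d x y / r)).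

Lemma plateau01 x r y : 0 <= plateau x r y <= 1.
Proof. by rewrite /plateau le_max lexx/= ge_max ler01 ge_min lexx. Qed.

Lemma plateau_in x r y : 0 < r -> d x y <= r -> plateau x r y = 1.
Proof.
move=> r0 xy; rewrite /plateau min_l ?max_r//.
by rewrite lerBrDr -lerBrDl (_ : 2 - 1 = 1) ?ler_pdivrMr ?mul1r//; ring.
Qed.

Lemma plateau_out x r y : 0 < r -> 2 * r <= d x y -> plateau x r y = 0.
Proof.
move=> r0 xy; rewrite /plateau max_l// ge_min; apply/orP; right.
by rewrite subr_le0 ler_pdivlMr.
Qed.

Lemma plateau_gt0 x r y : 0 < r -> 0 < plateau x r y -> d x y < 2 * r.
Proof. by move=> r0; rewrite !ltNge; apply: contra => /(plateau_out r0)->. Qed.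

Lemma plateau_continuous x r : continuous (plateau x r).
Proof.
move=> y; apply: (@continuous_max _ _ (fun=> 0) (fun y => Num.min 1 (2 - d x y / r))).
  exact: cst_continuous.
apply: (@continuous_min _ _ (fun=> 1) (fun y => 2 - d x y / r)); first exact: cst_continuous.
apply: cvgB; first exact: cst_continuous.
by apply: cvgM; [exact: dist_continuous|exact: cst_continuous].
Qed.

Definition condensation x := forall r, 0 < r -> ~ countable [set z | d x z < r].

(** Each such point lies in a countable ball whose centre belongs to one of countably many finite
    nets, and there are only countably many such balls. *)
Lemma countable_not_condensation : countable [set x | ~ condensation x].
Proof.
have e n : 0 < n.+1%:R^-1 :> R by rewrite invr_gt0.
have /choice[s sP] := fun n => dist_net (e n).
pose B n x := [set z | d x z < n.+1%:R^-1].
apply: (@sub_countable _ _ _ (\bigcup_(n in setT)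
    \bigcup_(x in [set x | x \in s n /\ countable (B n x)]) B n x)).
  apply: subset_card_le => x /= /existsNP[r /not_implyP[r0 /contrapT cr]].
  have [n nr] : exists n, 2 * n.+1%:R^-1 < r.
    exists (Num.truncn (2 / r)).
    by rewrite ltr_pdivrMr// mulrC -ltr_pdivrMr// truncnS_gt.
  have [y ys yx] := sP n x.
  exists n => //; exists y => //; split => //; apply: sub_countable cr.
  apply: subset_card_le => z /= yz; apply: le_lt_trans (dtri x y z) (lt_trans _ nr).
  by rewrite dC mulr_natl mulr2n ltrD.
apply: bigcup_countable => // n _; apply: bigcup_countable => [|x []//].
apply: (@sub_countable _ _ _ [set` s n]); last exact/finite_set_countable/finite_seq.
by apply: subset_card_le => x [].
Qed.

Lemma condensation_exists : ~ countable [set: K] -> exists x, condensation x.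
Proof.
move=> uK; apply: contrapT => nc; apply: uK.
apply: sub_countable countable_not_condensation; apply: subset_card_le => x _ /= cx.
by apply: nc; exists x.
Qed.

Lemma condensation_neighbour x r : condensation x -> 0 < r ->
  exists y, [/\ condensation y, 0 < d x y & d x y < r].
Proof.
move=> cx r0; apply: contrapT => nc; apply: (cx r r0).
apply: (@sub_countable _ _ _ ([set x] `|` [set x | ~ condensation x])).
  apply: subset_card_le => y /= xy; have [->|/eqP yx] := pselect (y = x); [by left|right].
  move=> cy; apply: nc; exists y; split => //; rewrite lt_def dge0 andbT.
  by apply: contra yx => /eqP; case: dm => _ /(_ x y)[h _] _ _ /h ->.
rewrite -bigcup2E; apply: bigcup_countable; first exact: countableP.
by move=> [|[|n]] _; [exact: countable1|exact: countable_not_condensation|exact: countable0].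
Qed.

End metric.

(** * A Cantor scheme in an uncountable compact metric space *)

Section cantor.
Context {R : realType} {K : compactHausdorffType} (d : K -> K -> R).
Hypothesis dm : is_metric d.
Hypothesis dn : forall x : K, nbhs x = nbhs_ball_ (fun y e => [set z | d y z < e]) x.

(** Each node carries a condensation point and a radius. The child [true] keeps the point, the child
    [false] moves to a nearby condensation point, and a plateau around the former is the splitting
    function. At the point of a node all mass therefore follows the branch to that node. *)
Lemma cantor_tree : ~ countable [set: K] ->
  exists (k : seq bool -> K) (v : K -> seq bool -> R),
  [/\ forall y, splitting (v y), forall s, continuous (v^~ s),
      forall s b t, v (k (t ++ b :: s)) s = b%:R &
      forall e, 0 < e -> exists N, forall t s, (N <= size s)%N -> d (k s) (k (t ++ s)) < e].
Proof.
have dxx x : d x x = 0 by case: dm => _ /(_ x x)[_ ->].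
have dC x y : d x y = d y x by case: dm.
have dtri x y z : d x z <= d x y + d y z by case: dm.
move=> /(condensation_exists dm dn)[x0 cx0].
have /choice[nb nbP] : forall p : K * R, exists y, condensation d p.1 -> 0 < p.2 ->
    [/\ condensation d y, 0 < d p.1 y & d p.1 y < p.2].
  move=> [x r] /=; have [cx|] := pselect (condensation d x); last by exists x.
  have [r0|] := pselect (0 < r); last by exists x.
  by have [y yP] := condensation_neighbour dm dn cx r0; exists y.
(* The first bound makes the plateau, which vanishes from distance [2 * rad] on, zero on the ball of
   the sibling. The second keeps both balls inside that of the parent and at least halves the
   radius. *)
pose rad (p : K * R) := Num.min (d p.1 (nb p) / 3) ((p.2 - d p.1 (nb p)) / 2).
pose nd := foldr (fun (b : bool) p => (if b then p.1 else nb p, rad p)) (x0, 1).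
have nd_cons b s : nd (b :: s) = (if b then (nd s).1 else nb (nd s), rad (nd s)) by [].
have ndP s : [/\ condensation d (nd s).1, 0 < (nd s).2 & (nd s).2 * (size s).+1%:R <= 1].
  elim: s => [|b s [cs r0 rs]]; first by rewrite /= mulr1; split.
  have [cy y0 yr] := nbP _ cs r0; rewrite nd_cons /=; split; first by case: b.
    by rewrite /rad lt_min !divr_gt0// subr_gt0.
  have : rad (nd s) <= (nd s).2 / 2 by rewrite ge_min; apply/orP; right; lra.
  move: rs; rewrite -[(size s).+2]addn1 -[(size s).+1]addn1 !natrD.
  have := ler0n R (size s); nra.
have step b s z : d (nd (b :: s)).1 z < rad (nd s) -> d (nd s).1 z < (nd s).2.
  have [cs r0 rs] := ndP s; have [cy y0 yr] := nbP _ cs r0.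
  have h : rad (nd s) <= ((nd s).2 - d (nd s).1 (nb (nd s))) / 2 by rewrite ge_min lexx orbT.
  rewrite nd_cons/=; case: b => h1; first by lra.
  by have := dtri (nd s).1 (nb (nd s)) z; lra.
have sub t s z : d (nd (t ++ s)).1 z < (nd (t ++ s)).2 -> d (nd s).1 z < (nd s).2.
  by elim: t => [//|b t IH] /= /step.
have desc t s : d (nd s).1 (nd (t ++ s)).1 < (nd s).2.
  by apply: (sub t); rewrite dxx; case: (ndP (t ++ s)).
exists (fun s => (nd s).1), (fun y s => plateau d (nd s).1 (rad (nd s)) y); split.
- by move=> y s; exact: plateau01.
- by move=> s; exact: plateau_continuous.
- move=> s b t; have := desc t (b :: s); rewrite nd_cons /=.
  have [cs r0 rs] := ndP s; have [cy y0 yr] := nbP _ cs r0.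
  have rad0 : 0 < rad (nd s) by rewrite /rad lt_min !divr_gt0// subr_gt0.
  have h : rad (nd s) <= d (nd s).1 (nb (nd s)) / 3 by rewrite ge_min lexx.
  case: b => h1; first by rewrite plateau_in// ltW.
  rewrite plateau_out//; set z := (nd _).1 in h1 *.
  by have := dtri (nd s).1 z (nb (nd s)); rewrite (dC z); lra.
move=> e e0; exists (Num.truncn e^-1) => t s Ns.
apply: lt_le_trans (desc t s) _; have [_ r0 rs] := ndP s.
rewrite leNgt; apply/negP => er.
suff : 1 < (nd s).2 * (size s).+1%:R by rewrite ltNge rs.
have : e^-1 < (size s).+1%:R by apply: lt_le_trans (truncnS_gt _) _; rewrite ler_nat.
by rewrite -ltf_pV2 ?qualifE/= ?invr_gt0// invrK => h; rewrite -ltr_pdivrMr// mul1r (lt_trans h).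
Qed.

End cantor.

(** * Averaging pairs *)

Section averaging.
Context {R : realType}.

(** The value 0 at discontinuous [F] is a default; it makes operators total whose continuity holds
    only on Cauchy or bounded sequences. *)
Definition cfun_of (X : topologicalType) (F : X -> R) : 'C(X, R) :=
  if pselect (continuous F) is left cF then cfun_mk cF else 0.

Lemma cfun_ofE (X : topologicalType) (F : X -> R) x : continuous F -> cfun_of F x = F x.
Proof. by rewrite /cfun_of; case: pselect. Qed.

Definition cfun_cst (X : topologicalType) (c : R) : 'C(X, R) :=
  cfun_mk (@cst_continuous X R c).

Lemma cfun_cstE (X : topologicalType) c (x : X) : cfun_cst X c x = c.
Proof. by []. Qed.

Definition useq_cauchy (X : topologicalType) (x : nat -> 'C(X, R)) :=
  forall e, 0 < e -> exists N, forall n m, (N <= n)%N -> (N <= m)%N ->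
    forall l, `|x n l - x m l| <= e.

Lemma useq_cauchy_lin (X : topologicalType) a (x y : nat -> 'C(X, R)) :
  useq_cauchy x -> useq_cauchy y -> useq_cauchy (fun n => a *: x n + y n).
Proof.
move=> cx cy e e0; have a0 : 0 < `|a| + 1 by rewrite ltr_wpDl.
have [N xN] := cx _ (divr_gt0 e0 (mulr_gt0 (ltr0Sn R 1) a0)).
have [N' yN] := cy (e / 2) (divr_gt0 e0 (ltr0Sn R 1)).
exists (maxn N N') => n m; rewrite !geq_max => /andP[Nn N'n] /andP[Nm N'm] l.
rewrite !cfunDE !cfunZE.
rewrite [X in `|X|](_ : _ = a * (x n l - x m l) + (y n l - y m l)); last by ring.
apply: le_trans (ler_normD _ _) _; rewrite normrM (splitr e) lerD ?yN//.
have : `|a| * `|x n l - x m l| <= (`|a| + 1) * (e / (2 * (`|a| + 1))).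
  by rewrite ler_pM ?xN// lerDl.
by rewrite (_ : (`|a| + 1) * (e / (2 * (`|a| + 1))) = e / 2)//; field; rewrite lt0r_neq0.
Qed.

Lemma useq_cauchy_cst (X : topologicalType) (f : 'C(X, R)) : useq_cauchy (fun=> f).
Proof. by move=> e e0; exists 0%N => n m _ _ l; rewrite subrr normr0 ltW. Qed.

(* The uniformly Cauchy sequences stand for C(L x {0, 1, ..., oo}). *)
Definition averaging_pair (K L : topologicalType)
    (P : 'C(K, R) -> nat -> 'C(L, R)) (J : (nat -> 'C(L, R)) -> 'C(K, R)) :=
  [/\ (forall f, useq_cauchy (P f)) /\ (forall x, useq_cauchy x -> P (J x) = x),
      forall a f g n, P (a *: f + g) n = a *: P f n + P g n,
      forall a x y, useq_cauchy x -> useq_cauchy y ->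
        J (fun n => a *: x n + y n) = a *: J x + J y,
      (forall f n, 0 <= f -> 0 <= P f n) /\
      (forall x, useq_cauchy x -> (forall n, 0 <= x n) -> 0 <= J x) &
      (forall n, P (cfun_cst K 1) n = cfun_cst L 1) /\
      J (fun=> cfun_cst L 1) = cfun_cst K 1].

Lemma charged_cat (u : seq bool -> R) t s : charged u (t ++ s) -> charged u s.
Proof. by elim: t => [//|b t IH] /= /andP[/IH]. Qed.

Lemma tavg_eq n (u u' w : seq bool -> R) s :
  (forall t, (size t < n)%N -> u (t ++ s) = u' (t ++ s)) ->
  tavg n u w s = tavg n u' w s.
Proof.
elim: n s => [//|n IH] s uu' /=; have /= -> := uu' [::] (ltn0Sn n).
by rewrite !IH// => t tn; rewrite -cat_rcons; apply: uu'; rewrite size_rcons ltnS.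
Qed.

End averaging.

(** * Splittings attached to the points of [L * nat] *)

Section tests.
Context {R : realType} {L : compactHausdorffType} (d : L -> L -> R).
Hypothesis dm : is_metric d.
Hypothesis dn : forall x : L, nbhs x = nbhs_ball_ (fun y e => [set z | d y z < e]) x.
Variables (l0 : L) (net : nat -> seq L).
Hypothesis netP : forall j l, exists2 c, c \in net j & d c l < j.+1%:R^-1.

(* The splittings used on [L * nat]: the [k]-th one either singles out an index [j],
   or tests the proximity to a point of the [j]-th net. *)
Definition test (k : nat) (m : L * nat) : R :=
  match unpickle k : option (nat + nat * nat) with
  | Some (inl j) => (m.2 == j)%:R
  | Some (inr (j, i)) => plateau d (nth l0 (net j) i) j.+1%:R^-1 m.1
  | None => 0
  end.

Lemma test01 k m : 0 <= test k m <= 1.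
Proof.
rewrite /test; case: unpickle => [[j|[j i]]|]; last by rewrite lexx ler01.
- by case: eqP; rewrite ?lexx ?ler01.
- exact: plateau01.
Qed.

Lemma test_continuous k n : continuous (fun l => test k (l, n)).
Proof.
rewrite /test; case: unpickle => [[j|[j i]]|] /=; try exact: cst_continuous.
exact: plateau_continuous.
Qed.

(** At each of the first [N] levels some branch is charged by both points, as happens when they
    charge a common node of depth [N]. *)
Definition untold N (m m' : L * nat) := forall k, (k < N)%N ->
  (0 < test k m /\ 0 < test k m') \/ (test k m < 1 /\ test k m' < 1).

Lemma untoldS N N' m m' : (N' <= N)%N -> untold N m m' -> untold N' m m'.
Proof. by move=> NN' h k kN; apply: h; exact: leq_trans kN NN'. Qed.

(** A net point close to the first coordinate of [m] gives a test equal to 1 at [m]. As [m] does not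
    charge the branch [false], the test is positive at [m'], which puts both first coordinates near
    that net point. *)
Lemma untold_fst (h : 'C(L, R)) e : 0 < e ->
  exists N, forall m m', untold N m m' -> `|h m.1 - h m'.1| <= e.
Proof.
move=> e0; have [r r0 rP] := dist_uniform_continuity dm dn h e0.
pose j := Num.truncn (3 / r).
have jr : 3 * j.+1%:R^-1 < r by rewrite ltr_pdivrMr// mulrC -ltr_pdivrMr// truncnS_gt.
pose code i : nat := pickle (inr (j, i) : nat + nat * nat).
exists (\max_(i < size (net j)) code i).+1 => -[l n] [l' n'] /= mm'; apply: rP.
have [c cs cl] := netP j l.
have ic : (index c (net j) < size (net j))%N by rewrite index_mem.
have /mm' : (code (index c (net j)) < (\max_(i < size (net j)) code i).+1)%N.
  by rewrite ltnS (leq_bigmax (Ordinal ic)).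
have j0 : 0 < j.+1%:R^-1 :> R by rewrite invr_gt0.
rewrite /test pickleK /= nth_index// (plateau_in j0 (ltW cl)) ltxx.
case=> [[_ /(plateau_gt0 j0) cl']|[]//].
case: dm => _ _ dC dtri; apply: le_lt_trans (dtri l c l') _; rewrite (dC l c).
by move: cl cl' jr; set z : R := _^-1; lra.
Qed.

(** The test that singles out an index takes only the values 0 and 1, so it charges one branch and
    tells that index from all others. *)
Lemma untold_snd N0 : exists N, forall m m', untold N m m' ->
  m.2 = m'.2 \/ ((N0 <= m.2)%N /\ (N0 <= m'.2)%N).
Proof.
pose code j : nat := pickle (inl j : nat + nat * nat).
exists (\max_(j < N0) code j).+1 => -[l n] [l' n'] /= mm'.
have key j : (j < N0)%N -> n = j \/ n' = j -> n = n'.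
  move=> jN; have /mm' : (code j < (\max_(j < N0) code j).+1)%N.
    by rewrite ltnS (leq_bigmax (Ordinal jN)).
  rewrite /test pickleK /=.
  have [->|nj] := eqVneq n j; have [->|nj'] := eqVneq n' j => //=; rewrite !ltxx.
  - by case=> -[].
  - by case=> -[].
  by move=> _ [] /eqP; rewrite ?(negbTE nj) ?(negbTE nj').
have [nN|Nn] := ltnP n N0; first by left; apply: key nN _; left.
have [nN'|Nn'] := ltnP n' N0; first by left; apply: key nN' _; right.
by right.
Qed.

Lemma untold_useq (x : nat -> 'C(L, R)) e : useq_cauchy x -> 0 < e ->
  exists N, forall m m', untold N m m' -> `|x m.2 m.1 - x m'.2 m'.1| <= e.
Proof.
move=> cx e0; have e3 : 0 < e / 3 by rewrite divr_gt0.
have [N0 N0P] := cx _ e3; have /choice[M MP] := fun n => untold_fst (x n) e3.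
have [N1 N1P] := untold_snd N0.
exists (maxn N1 (\max_(n < N0.+1) M n)) => m m' mm'.
have mn n : (n <= N0)%N -> `|x n m.1 - x n m'.1| <= e / 3.
  move=> nN; apply: MP; apply: untoldS mm'; rewrite leq_max; apply/orP; right.
  by rewrite -ltnS in nN; exact: (leq_bigmax (Ordinal nN)).
have [nN|Nn] := ltnP m.2 N0.
  have [<-|[]] := N1P _ _ (untoldS (leq_maxl _ _) mm'); last by rewrite leqNgt nN.
  by apply: le_trans (mn _ (ltnW nN)) _; lra.
have Nn' : (N0 <= m'.2)%N.
  by have [<-|[]] := N1P _ _ (untoldS (leq_maxl _ _) mm').
(* Both indices are now at least [N0]; the comparison passes through [x N0] at the two points. *)
have /ler_normlP[a1 a2] := mn _ (leqnn N0).
have /ler_normlP[b1 b2] := N0P _ _ Nn (leqnn N0) m.1.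
have /ler_normlP[c1 c2] := N0P _ _ Nn' (leqnn N0) m'.1.
by apply/ler_normlP; split; lra.
Qed.

Definition test_split m (s : seq bool) := test (size s) m.

Lemma charged_untold m m' s :
  charged (test_split m) s -> charged (test_split m') s -> untold (size s) m m'.
Proof.
elim: s => [//|b s IH] /= /andP[ms bm] /andP[ms' bm'] k.
rewrite ltnS leq_eqVlt => /predU1P[->|]; last exact: IH.
by case: b bm bm' => ? ?; [left|right].
Qed.

(* A node that no point charges inherits the point of its parent, so that
   [node_val_cauchy] holds along all branches. *)
Fixpoint node_pt (s : seq bool) : L * nat :=
  match pselect (exists m, charged (test_split m) s) with
  | left h => projT1 (cid h)
  | right _ => if s is _ :: s' then node_pt s' else (l0, 0%N)
  end.

Lemma node_pt_charged m s : charged (test_split m) s ->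
  charged (test_split (node_pt s)) s.
Proof.
move=> ms; case: s ms => [//|b s] ms; rewrite [node_pt _]/=.
by case: pselect => [h|[]]; [exact: (projT2 (cid h))|exists m].
Qed.

Definition node_val (x : nat -> 'C(L, R)) s : R := x (node_pt s).2 (node_pt s).1.

(** If some point charges the descendant, it also charges the ancestor, and the points chosen at the
    two nodes are untold by the tests above the ancestor. Otherwise the descendant has the value of
    its parent and induction applies. *)
Lemma node_val_cauchy x : useq_cauchy x -> tree_cauchy (node_val x).
Proof.
move=> cx e e0; have [N NP] := untold_useq cx e0; exists N => t s Ns.
elim: t => [|b t IH]; first by rewrite subrr normr0 ltW.
have [[m mts]|nm] := pselect (exists m, charged (test_split m) ((b :: t) ++ s)).
  have mts' := node_pt_charged mts.
  apply/NP/(untoldS Ns)/charged_untold; first exact: charged_cat mts'.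
  exact/node_pt_charged/(charged_cat mts').
rewrite (_ : node_val x ((b :: t) ++ s) = node_val x (t ++ s))//.
by rewrite /node_val /=; case: pselect.
Qed.

End tests.

(** * Existence of averaging pairs *)

Section averaging_pairs.
Context {R : realType} {K L : compactHausdorffType}.

(** The measures attached to [(l, n)] stabilise at each level as [n] grows, uniformly in [l]. This
    makes [P f] a uniformly Cauchy sequence. *)
Lemma test_stable (d : L -> L -> R) l0 net N : exists N0, forall k n m l,
  (k < N)%N -> (N0 <= n)%N -> (N0 <= m)%N -> test d l0 net k (l, n) = test d l0 net k (l, m).
Proof.
pose c k : nat := if unpickle k : option (nat + nat * nat) is Some (inl j) then j.+1 else 0%N.
exists (\max_(k < N) c k) => k n m l kN Nn Nm; rewrite /test.
have : (c k <= \max_(k < N) c k)%N by exact: (leq_bigmax (Ordinal kN)).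
rewrite /c; case: unpickle => [[j|[j i]]|]//= cj.
by rewrite !gtn_eqF// (leq_trans cj).
Qed.

(** [P] integrates [f \o k] against the measures of [L * nat], and [J] integrates node values
    against those of [K]. For a deep node [s] charged by [(l, n)], the measure of [k s] sits below
    [s], so [J x (k s)] is close to [val x s], and this to [x n l]; averaging over such [s] gives
    [P (J x) = x]. *)
Lemma averaging_pair_exists : metrizable R K -> metrizable R L ->
  ~ countable [set: K] -> [set: L] !=set0 ->
  exists (P : 'C(K, R) -> nat -> 'C(L, R)) (J : (nat -> 'C(L, R)) -> 'C(K, R)),
    averaging_pair P J.
Proof.
move=> [dK dmK dnK] [d dm dn] uK [l0 _].
have [k [v [v01 cv vk kk]]] := cantor_tree dmK dnK uK.
have /choice[net netP] : forall j : nat, exists s : seq L,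
    forall y, exists2 x, x \in s & d x y < j.+1%:R^-1.
  by move=> j; apply: (dist_net dn); rewrite invr_gt0.
pose u m := test_split d l0 net m; pose val := node_val d l0 net.
have u01 m : splitting (u m) by move=> s; exact: test01.
have cu n s : continuous (fun l => u (l, n) s) by exact: (test_continuous dm dn).
have ck (f : 'C(K, R)) : tree_cauchy (f \o k).
  move=> e e0; have [r r0 rP] := dist_uniform_continuity dmK dnK f e0.
  have [N NP] := kk _ r0; exists N => t s Ns /=; rewrite distrC; exact/rP/NP.
have cval x : useq_cauchy x -> tree_cauchy (val x) by exact: (node_val_cauchy dm dn l0 netP).
pose P (f : 'C(K, R)) n : 'C(L, R) := cfun_of (fun l => tlim (u (l, n)) (f \o k)).
pose J x : 'C(K, R) := cfun_of (fun y => tlim (v y) (val x)).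
have PE f n l : P f n l = tlim (u (l, n)) (f \o k).
  by rewrite cfun_ofE//; apply: tlim_continuous.
have JE x y : useq_cauchy x -> J x y = tlim (v y) (val x).
  by move=> cx; rewrite cfun_ofE//; apply: tlim_continuous => //; exact: cval.
have cP f : useq_cauchy (P f).
  move=> e e0; have e2 : 0 < e / 2 by rewrite divr_gt0.
  have [N NP] := ck f _ e2; have [N0 N0P] := test_stable d l0 net N.
  exists N0 => n m Nn Nm l; rewrite !PE.
  have := tlim_osc (u01 (l, n)) (ck f) (ltW e2) NP.
  rewrite (@tavg_eq _ _ _ (u (l, m))); last by move=> t tN; rewrite cats0; exact: N0P.
  have := tlim_osc (u01 (l, m)) (ck f) (ltW e2) NP.
  by move=> /ler_normlP[a1 a2] /ler_normlP[b1 b2]; apply/ler_normlP; split; lra.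
(* Above [s] the splits at the point [k s] are 0 or 1, so down to that depth only [s] and its
   ancestors, the suffixes of [s], are charged. *)
have vcharged s t : charged (v (k s)) t -> (size t <= size s)%N -> exists r, s = r ++ t.
  elim: t => [|b t IH] /=; first by exists s; rewrite cats0.
  move=> /andP[/IH {}IH bt] ts; have [r sr] := IH (ltnW ts).
  case: (lastP r) sr => [|{}r c] sr; first by rewrite sr ltnn in ts.
  exists r; rewrite -cat_rcons sr; congr (rcons _ _ ++ _).
  by move: bt; rewrite sr cat_rcons vk; case: b c {sr} => -[]; rewrite ?ltxx.
exists P, J; split; [split=> [//|x cx]| | |split| split].
- apply/funext => n; apply: cfunP => l; rewrite PE; apply/eqP; rewrite -subr_eq0; apply/eqP.
  apply: eq0_small => e e0; have e2 : 0 < e / 2 by rewrite divr_gt0.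
  have [N1 N1P] := cval _ cx _ e2.
  have [N2 N2P] := untold_useq dm dn l0 netP cx e2.
  apply: (tlim_near (N := maxn N1 N2)) (u01 _) (ck _) (ltW e0) _ => s.
  rewrite geq_max => /andP[N1s N2s] us /=; rewrite JE//.
  have osc : tree_osc (val x) (size s) (e / 2).
    by move=> t' s' ss'; apply: N1P; exact: leq_trans ss'.
  have := tlim_osc (v01 (k s)) (cval _ cx) (ltW e2) osc.
  have -> : tavg (size s) (v (k s)) (val x) [::] = val x s.
    apply/eqP; rewrite -subr_eq0 -normr_le0; apply: tavg_near => // t ts; rewrite cats0 => vt.
    have [r sr] := vcharged _ _ vt (eq_leq ts).
    move: (congr1 size sr); rewrite size_cat ts => /eqP.
    rewrite -[X in X == _]add0n eqn_add2r eq_sym size_eq0 => /eqP r0.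
    by rewrite sr r0 subrr normr0.
  have := N2P _ _ (untoldS N2s (charged_untold (node_pt_charged us) us)).
  rewrite -/(val x s) -/(val _ _) /=.
  rewrite /val /node_val => /ler_normlP[a1 a2] /ler_normlP[b1 b2].
  by apply/ler_normlP; split; lra.
- by move=> a f g n; apply: cfunP => l; rewrite cfunDE cfunZE !PE -tlim_lin.
- move=> a x y cx cy; apply: cfunP => z; rewrite cfunDE cfunZE !JE//.
    by rewrite -tlim_lin//; exact: cval.
  exact: useq_cauchy_lin.
- move=> f n /cfun_leP f0; apply/cfun_leP => l; rewrite PE; apply: tlim_ge0 => // t; exact: f0.
- move=> x cx x0; apply/cfun_leP => y; rewrite JE//; apply: tlim_ge0 => //; first exact: cval.
  by move=> t; have /cfun_leP := x0 (node_pt d l0 net t).2; exact.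
- by move=> n; apply: cfunP => l; rewrite PE [LHS]tlim_cst.
apply: cfunP => y; rewrite JE; last exact: useq_cauchy_cst.
by rewrite [LHS]tlim_cst.
Qed.

End averaging_pairs.

(** * Recursive sequences of continuous functions *)

Section resolvent.
Context {R : realType}.
Variables (s q : R).
Hypotheses (s1 : `|s| <= 1) (q1 : 1 < q).
Implicit Types (c : nat -> R) (B : R).

Let q0 : 0 < q. Proof. exact: lt_trans q1. Qed.
Let qV0 : 0 <= q^-1. Proof. by rewrite invr_ge0 ltW. Qed.
Let q10 : 0 < q - 1. Proof. by rewrite subr_gt0. Qed.

(* The partial sums of the Neumann series of [(q - s * shift)^-1]. *)
Fixpoint resum N c n : R :=
  if N is N'.+1 then (c n + s * resum N' c n.+1) / q else 0.

Let norm_sM (a : R) : `|s * a| <= `|a|.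
Proof. by rewrite normrM ler_piMl. Qed.

Let norm_step (a b A B : R) : `|a| <= A -> `|b| <= B -> `|(a + s * b) / q| <= (A + B) / q.
Proof.
move=> aA bB; rewrite normrM (ger0_norm qV0).
rewrite ler_pM2r ?invr_gt0//; apply: le_trans (ler_normD _ _) _.
by rewrite lerD// (le_trans (norm_sM _)).
Qed.

(** [B / (q - 1)] is the fixed point of [b |-> (B + b) / q], so one step of the recursion preserves
    it as a bound. *)
Let fixpointE B : (B + B / (q - 1)) / q = B / (q - 1).
Proof. by field; rewrite !lt0r_neq0. Qed.

Lemma resum_bound N c n B : (forall n, `|c n| <= B) -> `|resum N c n| <= B / (q - 1).
Proof.
move=> cB; elim: N n => [|N IH] n /=.
  by rewrite normr0 divr_ge0 ?(ltW q10)// (le_trans _ (cB 0%N)).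
by rewrite -fixpointE; apply: norm_step.
Qed.

Lemma resum_step m N c n B : (forall n, `|c n| <= B) ->
  `|resum (m + N) c n - resum N c n| <= B / (q - 1) * q^-1 ^+ N.
Proof.
move=> cB; elim: N n => [|N IH] n.
  by rewrite addn0 subr0 expr0 mulr1; exact: resum_bound.
rewrite addnS /=.
rewrite [X in `|X|](_ : _ =
  (0 + s * (resum (m + N) c n.+1 - resum N c n.+1)) / q); last by ring.
apply: le_trans (norm_step (A := 0) _ (IH _)) _; first by rewrite normr0.
by rewrite add0r exprSr mulrA.
Qed.

Lemma resum_tail N c d N0 : (forall n m, (N0 <= n)%N -> (N0 <= m)%N -> `|c n - c m| <= d) ->
  forall n m, (N0 <= n)%N -> (N0 <= m)%N -> `|resum N c n - resum N c m| <= d / (q - 1).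
Proof.
move=> cd; elim: N => [|N IH] n m Nn Nm /=.
  rewrite subrr normr0 divr_ge0 ?(ltW q10)//.
  by apply: le_trans (cd N0 N0 _ _).
rewrite -fixpointE [X in `|X|](_ : _ =
  ((c n - c m) + s * (resum N c n.+1 - resum N c m.+1)) / q); last by ring.
by apply: norm_step; [exact: cd|apply: IH; exact: leqW].
Qed.

Lemma geometric_small (B e : R) : 0 < e -> exists N, B * q^-1 ^+ N <= e.
Proof.
move=> e0; have : (fun N => B * q^-1 ^+ N) @ \oo --> B * 0.
  apply: cvgM; first exact: cvg_cst.
  by apply: cvg_expr; rewrite (ger0_norm qV0) invf_lt1.
rewrite mulr0 => /cvgrPdist_le/(_ _ e0)[N _ NP].
by exists N; have /= := NP N (leqnn N); rewrite sub0r normrN; apply: le_trans (ler_norm _).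
Qed.

Lemma resum_cvg c n B : (forall n, `|c n| <= B) -> cvgn (fun N => resum N c n).
Proof.
move=> cB; apply: near_stable_cvg => e e0.
have [N Ne] := geometric_small (B / (q - 1)) e0; exists N => m.
by apply: le_trans Ne; apply: resum_step.
Qed.

End resolvent.

Section resolvent_cfun.
Context {R : realType} {X : topologicalType}.
Implicit Types (c e b : nat -> 'C(X, R)).

Definition ubounded c := exists B : R, forall n x, `|c n x| <= B.

Lemma ubounded_lin (a : R) c c' : ubounded c -> ubounded c' ->
  ubounded (fun n => a *: c n + c' n).
Proof.
move=> [B cB] [B' cB']; exists (`|a| * B + B') => n x; rewrite cfunDE cfunZE.
by apply: le_trans (ler_normD _ _) _; rewrite normrM lerD// ler_wpM2l.
Qed.

(** The operator [(q - s * shift)^-1] on bounded sequences. At [s = -1] it inverts [q + shift]; at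
    [s = 1] it is positive and dominates that inverse. *)
Definition resolvent (s q : R) c n : 'C(X, R) :=
  cfun_of (fun x => limn (fun N => resum s q N (c^~ x) n)).

Variables (s q : R).
Hypotheses (s1 : `|s| <= 1) (q1 : 1 < q).

Let q0 : 0 < q. Proof. exact: lt_trans q1. Qed.
Let qV0 : 0 <= q^-1. Proof. by rewrite invr_ge0 ltW. Qed.
Let q10 : 0 < q - 1. Proof. by rewrite subr_gt0. Qed.

Lemma resum_continuous c N n : continuous (fun x => resum s q N (c^~ x) n).
Proof.
elim: N n => [|N IH] n x /=; first exact: cst_continuous.
apply: cvgM; last exact: cst_continuous.
apply: cvgD; first exact: cfun_continuous.
by apply: cvgM; [exact: cst_continuous|exact: IH].
Qed.

Lemma resolventE c n x : ubounded c ->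
  resolvent s q c n x = limn (fun N => resum s q N (c^~ x) n).
Proof.
move=> [B cB]; rewrite cfun_ofE//; apply: uniform_approx_continuous => e e0.
have [N Ne] := geometric_small q1 (B / (q - 1)) e0.
exists (fun x => resum s q N (c^~ x) n); first exact: resum_continuous.
move=> y; apply: (limn_near (N := N)); first exact: (resum_cvg s1 q1 (B := B)).
by move=> m; apply: le_trans Ne; apply: resum_step.
Qed.

Lemma resolvent_eq c n : ubounded c ->
  q *: resolvent s q c n = c n + s *: resolvent s q c n.+1.
Proof.
move=> bc; have [B cB] := bc; apply: cfunP => x.
rewrite cfunDE !cfunZE !resolventE//.
have cv m : cvgn (fun N => resum s q N (c^~ x) m) by exact: (resum_cvg s1 q1 (B := B)).
have <- : limn (fun N => resum s q N.+1 (c^~ x) n) = limn (fun N => resum s q N (c^~ x) n).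
  by apply: cvg_lim => //; have := cv n; rewrite -cvg_shiftS.
rewrite (_ : (fun N => _) = fun N => s / q * resum s q N (c^~ x) n.+1 + c n x / q); last first.
  by apply/funext => N /=; ring.
rewrite limn_lin ?lim_cst//; last exact: cvg_cst.
by field; rewrite lt0r_neq0.
Qed.

Lemma resolvent_bound c B n x : (forall n x, `|c n x| <= B) ->
  `|resolvent s q c n x| <= B / (q - 1).
Proof.
move=> cB; rewrite resolventE; last by exists B.
rewrite -[X in `|X|]subr0; apply: (limn_near (N := 0%N)).
  exact: (resum_cvg s1 q1 (B := B)).
by move=> m; rewrite subr0; apply: resum_bound.
Qed.

Lemma resolvent_ubounded c : ubounded c -> ubounded (resolvent s q c).
Proof. by move=> [B cB]; exists (B / (q - 1)) => n x; exact: resolvent_bound. Qed.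

(** The difference of two bounded solutions at [n] is [s / q] times that at [n.+1]; iterating [N]
    times bounds it by [B * q^-1 ^+ N]. *)
Lemma resolvent_uniq c e : ubounded c -> ubounded e ->
  (forall n, q *: e n = c n + s *: e n.+1) -> e = resolvent s q c.
Proof.
move=> bc be ee; have [B dB] := ubounded_lin (-1) be (resolvent_ubounded bc).
apply/funext => n; apply: cfunP => x; apply/eqP; rewrite -subr_eq0; apply/eqP.
apply: eq0_small => eps eps0; have [N Ne] := geometric_small q1 B eps0.
apply: le_trans Ne; elim: N n => [|N IH] n.
  by rewrite expr0 mulr1; have := dB n x; rewrite cfunDE cfunZE mulN1r -normrN opprD opprK.
have := congr1 (fun f : 'C(X, R) => f x) (ee n).
have := congr1 (fun f : 'C(X, R) => f x) (resolvent_eq n bc).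
rewrite !cfunDE !cfunZE => h1 h2.
have -> : e n x - resolvent s q c n x = s * (e n.+1 x - resolvent s q c n.+1 x) / q.
  by apply: (mulfI (lt0r_neq0 q0)); rewrite mulrBr h1 h2; field; rewrite lt0r_neq0.
rewrite normrM (ger0_norm qV0) exprSr mulrA.
rewrite ler_pM2r ?invr_gt0//; apply: le_trans (IH n.+1).
by rewrite normrM ler_piMl.
Qed.

Lemma resolvent_lin a c c' : ubounded c -> ubounded c' ->
  resolvent s q (fun n => a *: c n + c' n) =
  (fun n => a *: resolvent s q c n + resolvent s q c' n).
Proof.
move=> bc bc'; symmetry; apply: resolvent_uniq.
- exact: ubounded_lin.
- by apply: ubounded_lin; exact: resolvent_ubounded.
move=> n; rewrite !scalerDr !scalerA [q * a]mulrC [s * a]mulrC -!scalerA.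
by rewrite !resolvent_eq// scalerDr addrACA.
Qed.

Lemma resolvent_cauchy c : ubounded c -> useq_cauchy c -> useq_cauchy (resolvent s q c).
Proof.
move=> bc cc e e0; have [N0 N0P] := cc _ (mulr_gt0 e0 q10); exists N0 => n m Nn Nm x.
have [B cB] := bc; rewrite !resolventE//.
have cv k : cvgn (fun N => resum s q N (c^~ x) k) by exact: (resum_cvg s1 q1 (B := B)).
rewrite addrC -mulN1r -limn_lin//; rewrite -[X in `|X|]subr0.
apply: (limn_near (N := 0%N)) => [|N]; first exact: cvgn_lin.
rewrite subr0 mulN1r addrC -[e](mulfK (lt0r_neq0 q10)).
by apply: (resum_tail s1 q1) Nn Nm => k l Nk Nl; exact: N0P.
Qed.

(** At [s = -1] this recovers a sequence from its first term [x] and from its image [b] under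
    [1 + q * shift]. *)
Fixpoint affine_rec (x : 'C(X, R)) b n : 'C(X, R) :=
  if n is n'.+1 then q^-1 *: (b n' + s *: affine_rec x b n') else x.

Lemma affine_rec_lin a x b x' b' :
  affine_rec (a *: x + x') (fun n => a *: b n + b' n) =
  (fun n => a *: affine_rec x b n + affine_rec x' b' n).
Proof.
apply/funext; elim=> [//|n IH] /=; rewrite IH; apply: cfunP => z.
by rewrite !(cfunDE, cfunZE); ring.
Qed.

End resolvent_cfun.

(** * Domination, and its preservation by averaging pairs *)

Section domination.
Context {R : realType}.

Definition dominated (X : topologicalType) (f g : 'C(X, R)) := forall x, `|f x| <= g x.

Lemma dominated_ge0 (X : topologicalType) (f g : 'C(X, R)) : dominated f g -> 0 <= g.
Proof. by move=> fg; apply/cfun_leP => x; apply: le_trans (fg x). Qed.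

(** Writing domination as positivity of two linear combinations lets it pass through any positive
    linear map. *)
Lemma dominatedP (X : topologicalType) (f g : 'C(X, R)) :
  dominated f g <-> 0 <= 1 *: f + g /\ 0 <= -1 *: f + g.
Proof.
split=> [fg|[/cfun_leP fg /cfun_leP gf] x].
  by split; apply/cfun_leP => x; rewrite cfunDE cfunZE cfun0E; have /ler_normlP[] := fg x; lra.
have := fg x; have := gf x; rewrite !cfunDE !cfunZE !cfun0E => h1 h2.
by apply/ler_normlP; split; lra.
Qed.

Lemma dominated_refl (X : topologicalType) (f : 'C(X, R)) : 0 <= f -> dominated f f.
Proof. by move=> /cfun_leP f0 x; rewrite ger0_norm//; exact: f0. Qed.

Lemma dominated_comb (X : topologicalType) (a b : R) (f g f' g' : 'C(X, R)) :
  `|a| <= b -> dominated f f' -> dominated g g' -> dominated (a *: f + g) (b *: f' + g').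
Proof.
move=> ab ff gg x; rewrite !cfunDE !cfunZE.
by apply: le_trans (ler_normD _ _) _; rewrite lerD// normrM ler_pM.
Qed.

Lemma dominated_norm (X : compactHausdorffType) (f : 'C(X, R)) :
  dominated f (`|f| *: cfun_cst X 1).
Proof. by move=> x; rewrite cfunZE mulr1; exact: cfun_norm_ub. Qed.

Context {K L : compactHausdorffType}.
Variables (P : 'C(K, R) -> nat -> 'C(L, R)) (J : (nat -> 'C(L, R)) -> 'C(K, R)).
Hypothesis PJ : averaging_pair P J.

Lemma avgP_cauchy f : useq_cauchy (P f). Proof. by case: PJ => -[]. Qed.

Lemma avgP_J x : useq_cauchy x -> P (J x) = x. Proof. by case: PJ => -[_ +] _ _ _ _; exact. Qed.

Lemma avgP_lin a f g : P (a *: f + g) = (fun n => a *: P f n + P g n).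
Proof. by apply/funext => n; case: PJ => _ + _ _ _; exact. Qed.

Lemma avgJ_lin a x y : useq_cauchy x -> useq_cauchy y ->
  J (fun n => a *: x n + y n) = a *: J x + J y.
Proof. by case: PJ => _ _ + _ _; exact. Qed.

Lemma avgP_dominated f g n : dominated f g -> dominated (P f n) (P g n).
Proof.
case: PJ => _ lP _ [pP _] _ /dominatedP[fg gf].
by apply/dominatedP; split; rewrite -lP; exact: pP.
Qed.

Lemma avgJ_dominated x y : useq_cauchy x -> useq_cauchy y ->
  (forall n, dominated (x n) (y n)) -> dominated (J x) (J y).
Proof.
case: PJ => _ _ lJ [_ pJ] _ cx cy xy.
by apply/dominatedP; split; rewrite -lJ//; apply: pJ;
  do ?[exact: useq_cauchy_lin|move=> n; case: (iffLR (dominatedP _ _) (xy n))].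
Qed.

Lemma avgP_cst c n : P (cfun_cst K c) n = cfun_cst L c.
Proof.
have P0 m : P 0 m = 0.
  by rewrite -[0 in LHS](addNr (0 : 'C(K, R))) -scaleN1r avgP_lin scaleN1r addNr.
have -> : cfun_cst K c = c *: cfun_cst K 1 + 0.
  by apply: cfunP => x; rewrite cfunDE cfunZE mulr1 addr0.
rewrite avgP_lin P0; case: PJ => _ _ _ _ [-> _].
by apply: cfunP => x; rewrite cfunDE cfunZE mulr1 addr0.
Qed.

Lemma avgJ_cst c : J (fun=> cfun_cst L c) = cfun_cst K c.
Proof.
have -> : (fun=> cfun_cst L c) = (fun _ : nat => (c - 1) *: cfun_cst L 1 + cfun_cst L 1).
  by apply/funext => n; apply: cfunP => x; rewrite cfunDE cfunZE mulr1 subrK.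
rewrite avgJ_lin; try exact: useq_cauchy_cst.
case: PJ => _ _ _ _ [_ ->].
by apply: cfunP => x; rewrite cfunDE cfunZE mulr1 subrK.
Qed.

Lemma avgP_ubounded f : ubounded (P f).
Proof.
exists `|f| => n x; have := avgP_dominated n (dominated_norm f) x.
rewrite (_ : _ *: _ = cfun_cst K `|f|) ?avgP_cst//.
by apply: cfunP => y; rewrite cfunZE mulr1.
Qed.

End domination.

(** * Convergence and domination for the recursions *)

Section sequences.
Context {R : realType} {X : compactHausdorffType}.
Implicit Types (f : 'C(X, R)) (x b : nat -> 'C(X, R)).

Definition scons f x n := if n is n'.+1 then x n' else f.

Lemma scons_cauchy f x : useq_cauchy x -> useq_cauchy (scons f x).
Proof.
move=> cx e e0; have [N NP] := cx _ e0.
by exists N.+1 => -[//|n] [//|m]; exact: NP.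
Qed.

Lemma shift_cauchy x : useq_cauchy x -> useq_cauchy (fun n => x n.+1).
Proof.
move=> cx e e0; have [N NP] := cx _ e0.
by exists N => n m Nn Nm; apply: NP; exact: leqW.
Qed.

Lemma scons_lin a f g x y :
  scons (a *: f + g) (fun n => a *: x n + y n) = (fun n => a *: scons f x n + scons g y n).
Proof. by apply/funext => -[]. Qed.

Variables (s q : R).
Hypotheses (s1 : `|s| <= 1) (q1 : 1 < q).

Let q0 : 0 < q. Proof. exact: lt_trans q1. Qed.
Let qV0 : 0 <= q^-1. Proof. by rewrite invr_ge0 ltW. Qed.
Let q10 : 0 < q - 1. Proof. by rewrite subr_gt0. Qed.

Lemma affine_rec_ubounded f b : ubounded b -> ubounded (affine_rec s q f b).
Proof.
move=> [B bB]; exists (`|f| + `|B| / (q - 1)) => n x; elim: n => [|n IH] /=.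
  by apply: le_trans (cfun_norm_ub f x) _; rewrite lerDl divr_ge0// ltW.
rewrite cfunZE cfunDE cfunZE normrM (ger0_norm qV0) mulrC ler_pdivrMr//.
apply: le_trans (ler_normD _ _) _; rewrite normrM.
have h1 : `|b n x| <= `|B| by apply: le_trans (bB n x) (ler_norm _).
have h2 : `|s| * `|affine_rec s q f b n x| <= `|f| + `|B| / (q - 1).
  by apply: le_trans IH; rewrite ler_piMl.
apply: le_trans (lerD h1 h2) _; rewrite mulrDl.
have -> : `|B| / (q - 1) * q = `|B| + `|B| / (q - 1) by field; rewrite lt0r_neq0.
have := ler_peMr (normr_ge0 f) (ltW q1); lra.
Qed.

Lemma affine_rec_cauchy f b : ubounded b -> useq_cauchy b -> useq_cauchy (affine_rec s q f b).
Proof.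
move=> bb cb e e0; have e2 : 0 < e / 2 by rewrite divr_gt0.
have [B aB] := affine_rec_ubounded f bb.
have [N NP] := cb _ (mulr_gt0 e2 q10).
have [k kP] := geometric_small q1 (B + B) e2.
(* Advancing both indices contracts the difference by [q^-1], while the variation of [b], at most
   [e / 2 * (q - 1)], contributes an error whose fixed point is [e / 2]. *)
have key i n m (y : X) : (N <= n)%N -> (N <= m)%N ->
    `|affine_rec s q f b (i + n) y - affine_rec s q f b (i + m) y| <= e / 2 + (B + B) * q^-1 ^+ i.
  move=> Nn Nm; elim: i => [|i IH].
    rewrite expr0 mulr1; apply: le_trans (ler_normB _ _) _.
    by apply: ler_wpDl; [exact: ltW|exact: lerD].
  rewrite /= !cfunZE !cfunDE !cfunZE -mulrBr normrM (ger0_norm qV0) mulrC ler_pdivrMr//.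
  rewrite [X in `|X|](_ : _ = (b (i + n)%N y - b (i + m)%N y) +
    s * (affine_rec s q f b (i + n) y - affine_rec s q f b (i + m) y)); last by ring.
  apply: le_trans (ler_normD _ _) _.
  have h1 : `|b (i + n)%N y - b (i + m)%N y| <= e / 2 * (q - 1).
    by apply: NP; rewrite (leq_trans _ (leq_addl _ _)).
  have h2 : `|s * (affine_rec s q f b (i + n) y - affine_rec s q f b (i + m) y)| <=
      e / 2 + (B + B) * q^-1 ^+ i by rewrite normrM; apply: le_trans IH; rewrite ler_piMl.
  apply: le_trans (lerD h1 h2) _.
  rewrite (_ : (e / 2 + _) * q = e / 2 * q + (B + B) * (q^-1 ^+ i.+1 * q)); last by ring.
  by rewrite exprSr mulfVK ?lt0r_neq0//; lra.
exists (k + N)%N => n m kn km x.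
have kn' : (k <= n)%N by apply: leq_trans kn; exact: leq_addr.
have km' : (k <= m)%N by apply: leq_trans km; exact: leq_addr.
have := key k (n - k)%N (m - k)%N x; rewrite !leq_subRL// => /(_ kn km).
by rewrite !subnKC// => h; apply: le_trans h _; rewrite [leRHS]splitr lerD2l.
Qed.

Lemma affine_rec_uniq f b x : x 0%N = f -> (forall n, q *: x n.+1 = b n + s *: x n) ->
  x = affine_rec s q f b.
Proof.
move=> x0 xS; apply/funext; elim=> [//|n IH] /=.
by rewrite -IH -xS scalerA mulVf ?scale1r// lt0r_neq0.
Qed.

Lemma affine_rec_dominated f f' b b' : dominated f f' -> (forall n, dominated (b n) (b' n)) ->
  forall n, dominated (affine_rec s q f b n) (affine_rec 1 q f' b' n).
Proof.
move=> ff bb; elim=> [//|n IH] /= x; rewrite !cfunZE normrM (ger0_norm qV0).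
by rewrite ler_wpM2l// [b n + _]addrC [b' n + _]addrC; exact: dominated_comb.
Qed.

Lemma resolvent_dominated b b' : ubounded b -> ubounded b' ->
  (forall n, dominated (b n) (b' n)) -> forall n, dominated (resolvent s q b n) (resolvent 1 q b' n).
Proof.
move=> ub ub' bb n x; rewrite !resolventE ?normr1//.
have [B bB] := ub; have [B' bB'] := ub'.
have cb : cvgn (fun N => resum s q N (b^~ x) n) := resum_cvg s1 q1 (bB^~ x).
have s11 : `|1 : R| <= 1 by rewrite normr1.
have cb' : cvgn (fun N => resum 1 q N (b'^~ x) n) := resum_cvg s11 q1 (bB'^~ x).
have cd : (fun N => `|resum s q N (b^~ x) n|) @ \oo --> `|limn (fun N => resum s q N (b^~ x) n)|.
  exact: cvg_norm.
rewrite -(cvg_lim _ cd)//; apply: ler_lim => //; first by apply/cvg_ex; eexists; exact: cd.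
near=> N; elim: {+}N n {cb cb' cd} => [|M IH] n /=; first by rewrite normr0.
rewrite normrM (ger0_norm qV0) ler_wpM2r// mul1r; apply: le_trans (ler_normD _ _) _.
by apply: lerD; [exact: bb|rewrite normrM; apply: le_trans (IH n.+1); rewrite ler_piMl].
Unshelve. all: end_near. Qed.

End sequences.

(** * The isomorphism *)

Section isomorphism.
Context {R : realType} {K L : compactHausdorffType}.
Variables (P : 'C(K, R) -> nat -> 'C(L, R)) (J : (nat -> 'C(L, R)) -> 'C(K, R)).
Variables (P' : 'C(L, R) -> nat -> 'C(K, R)) (J' : (nat -> 'C(K, R)) -> 'C(L, R)).
Hypotheses (PJ : averaging_pair P J) (PJ' : averaging_pair P' J').
Variable mu : R.
Hypothesis mu1 : 1 < mu.

(* With this value the sequence [bwd_seq 1] of the function [1] is constant, see [bwd1_cst]. *)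
Let la := mu / (mu - 1).

Let mu0 : 0 < mu. Proof. exact: lt_trans mu1. Qed.
Let mu10 : 0 < mu - 1. Proof. by rewrite subr_gt0. Qed.
Let la1 : 1 < la. Proof. by rewrite /la ltr_pdivlMr// mul1r ltrBlDr ltrDl. Qed.
Let la0 : 0 < la. Proof. exact: lt_trans la1. Qed.
Let la10 : 0 < 1 + la. Proof. by rewrite addr_gt0. Qed.

(** The second component of the isomorphism of [C(K)] onto the sum of [C(L)] and [C(K)]; the first
    is [P f 0]. *)
Definition middle (f : 'C(K, R)) := la *: J (fun n => P f n.+1) + f.

(** The factor [(1 + la)^-1] normalises [middle], which sends 1 to [1 + la]. *)
Definition fwd f : 'C(L, R) :=
  mu *: J' (scons ((1 + la)^-1 *: middle f) (P' (P f 0%N))) + P f 0%N.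

(* [bwd (-1)] is the inverse of [fwd], and [bwd 1] is a positive operator dominating it *)
Section backward.
Variable s : R.

(** At [s = -1] and [g = fwd f], these four formulas yield in turn [middle f], [P f 0], the sequence
    [P f], and [f]. *)
Definition bwd_mid g := (1 + la) *: resolvent s mu (P' g) 0%N.
Definition bwd_fst g := (s * mu) *: J' (resolvent s mu (P' g)) + g.
Definition bwd_seq g := affine_rec s la (bwd_fst g) (P (bwd_mid g)).
Definition bwd g : 'C(K, R) := (s * la) *: J (fun n => bwd_seq g n.+1) + bwd_mid g.

Hypothesis s1 : `|s| <= 1.

Lemma bwd_res_cauchy g : useq_cauchy (resolvent s mu (P' g)).
Proof.
by apply: resolvent_cauchy => //; [exact: (avgP_ubounded PJ')|exact: (avgP_cauchy PJ')].
Qed.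

Lemma bwd_seq_cauchy g : useq_cauchy (fun n => bwd_seq g n.+1).
Proof.
apply: shift_cauchy; apply: affine_rec_cauchy => //.
  exact: (avgP_ubounded PJ).
exact: (avgP_cauchy PJ).
Qed.

Lemma bwd_linear a f g : bwd (a *: f + g) = a *: bwd f + bwd g.
Proof.
have rl : resolvent s mu (P' (a *: f + g)) =
    fun n => a *: resolvent s mu (P' f) n + resolvent s mu (P' g) n.
  by rewrite (avgP_lin PJ') resolvent_lin//; exact: (avgP_ubounded PJ').
have ml : bwd_mid (a *: f + g) = a *: bwd_mid f + bwd_mid g.
  by apply: cfunP => x; rewrite /bwd_mid rl !(cfunDE, cfunZE); ring.
have fl : bwd_fst (a *: f + g) = a *: bwd_fst f + bwd_fst g.
  rewrite /bwd_fst rl (avgJ_lin PJ'); [|exact: bwd_res_cauchy..].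
  by apply: cfunP => x; rewrite !(cfunDE, cfunZE); ring.
have sl : bwd_seq (a *: f + g) = fun n => a *: bwd_seq f n + bwd_seq g n.
  by rewrite /bwd_seq ml fl (avgP_lin PJ) affine_rec_lin.
rewrite /bwd ml sl (avgJ_lin PJ); [|exact: bwd_seq_cauchy..].
by apply: cfunP => x; rewrite !(cfunDE, cfunZE); ring.
Qed.

End backward.

Lemma norm11 : `|1 : R| <= 1. Proof. by rewrite normr1. Qed.
Lemma normN11 : `|-1 : R| <= 1. Proof. by rewrite normrN normr1. Qed.

Lemma bwd_dominated s g g' : `|s| <= 1 -> dominated g g' -> dominated (bwd s g) (bwd 1 g').
Proof.
move=> s1 gg.
have rd : forall n, dominated (resolvent s mu (P' g) n) (resolvent 1 mu (P' g') n).
  apply: resolvent_dominated => //; try exact: (avgP_ubounded PJ').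
  by move=> n; exact: (avgP_dominated PJ').
have md : dominated (bwd_mid s g) (bwd_mid 1 g').
  by move=> x; rewrite /bwd_mid !cfunZE normrM (gtr0_norm la10) ler_wpM2l ?(ltW la10)//; exact: rd.
have fd : dominated (bwd_fst s g) (bwd_fst 1 g').
  rewrite /bwd_fst mul1r; apply: dominated_comb => //.
    by rewrite normrM (gtr0_norm mu0) ler_piMl// ltW.
  by apply: (avgJ_dominated PJ') => //; apply: bwd_res_cauchy => //; exact: norm11.
have sd : forall n, dominated (bwd_seq s g n) (bwd_seq 1 g' n).
  by apply: affine_rec_dominated => // n; exact: (avgP_dominated PJ).
rewrite /bwd mul1r; apply: dominated_comb => //.
  by rewrite normrM (gtr0_norm la0) ler_piMl// ltW.
by apply: (avgJ_dominated PJ) => //; apply: bwd_seq_cauchy => //; exact: norm11.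
Qed.

Lemma bwd1_cst : bwd 1 (cfun_cst L 1) =
  cfun_cst K ((2 * mu - 1) * (mu + 1) / (mu - 1) ^+ 2).
Proof.
have P1 : P' (cfun_cst L 1) = fun=> cfun_cst K 1.
  by apply/funext => n; rewrite (avgP_cst PJ').
have r1 : resolvent 1 mu (P' (cfun_cst L 1)) = fun=> cfun_cst K (mu - 1)^-1.
  rewrite P1; symmetry; apply: resolvent_uniq => //; first exact: norm11.
  - by exists 1 => n x; rewrite normr1.
  - by exists `|(mu - 1)^-1|.
  by move=> n; apply: cfunP => x; rewrite cfunDE !cfunZE !cfun_cstE; field; rewrite lt0r_neq0.
have m1 : bwd_mid 1 (cfun_cst L 1) = cfun_cst K ((1 + la) / (mu - 1)).
  by apply: cfunP => x; rewrite /bwd_mid r1 cfunZE.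
have f1 : bwd_fst 1 (cfun_cst L 1) = cfun_cst L ((2 * mu - 1) / (mu - 1)).
  rewrite /bwd_fst r1 (avgJ_cst PJ'); apply: cfunP => x.
  by rewrite cfunDE cfunZE !cfun_cstE; field; rewrite lt0r_neq0.
(* By the choice of [la], this constant is [1 + la] and [la - 1] is [(mu - 1)^-1], so it is the
   fixed point of the recursion. *)
have s1 : bwd_seq 1 (cfun_cst L 1) = fun=> cfun_cst L ((2 * mu - 1) / (mu - 1)).
  symmetry; apply: affine_rec_uniq => // n; apply: cfunP => x.
  rewrite cfunDE !cfunZE m1 (avgP_cst PJ) !cfun_cstE /la.
  by field; rewrite lt0r_neq0.
rewrite /bwd s1 m1 (avgJ_cst PJ); apply: cfunP => x; rewrite cfunDE cfunZE !cfun_cstE /la.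
by field; rewrite lt0r_neq0.
Qed.

Lemma fwd_scons_cauchy f :
  useq_cauchy (scons ((1 + la)^-1 *: middle f) (P' (P f 0%N))).
Proof. by apply: scons_cauchy; exact: (avgP_cauchy PJ'). Qed.

Lemma fwd_shift_cauchy f : useq_cauchy (fun n => P f n.+1).
Proof. by apply: shift_cauchy; exact: (avgP_cauchy PJ). Qed.

Lemma middle_linear a f g : middle (a *: f + g) = a *: middle f + middle g.
Proof.
rewrite /middle (avgP_lin PJ) (avgJ_lin PJ); [|exact: fwd_shift_cauchy..].
by apply: cfunP => x; rewrite !(cfunDE, cfunZE); ring.
Qed.

Lemma fwd_linear a f g : fwd (a *: f + g) = a *: fwd f + fwd g.
Proof.
rewrite /fwd middle_linear (avgP_lin PJ) (avgP_lin PJ').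
rewrite (_ : _^-1 *: (a *: middle f + middle g) =
  a *: ((1 + la)^-1 *: middle f) + (1 + la)^-1 *: middle g); last first.
  by rewrite scalerDr !scalerA mulrC.
rewrite scons_lin (avgJ_lin PJ'); [|exact: fwd_scons_cauchy..].
by apply: cfunP => x; rewrite !(cfunDE, cfunZE); ring.
Qed.

Lemma fwd_dominated f g : dominated f g -> dominated (fwd f) (fwd g).
Proof.
move=> fg; have md : dominated (middle f) (middle g).
  rewrite /middle; apply: dominated_comb => //.
    by rewrite gtr0_norm.
  apply: (avgJ_dominated PJ) => [||n]; try exact: fwd_shift_cauchy.
  exact: (avgP_dominated PJ).
have pd := avgP_dominated PJ 0 fg.
rewrite /fwd; apply: dominated_comb => //; first by rewrite gtr0_norm.
apply: (avgJ_dominated PJ') => [||[|n]]; try exact: fwd_scons_cauchy.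
  by move=> x; rewrite /= !cfunZE normrM gtr0_norm ?invr_gt0// ler_wpM2l// invr_ge0 ltW.
exact: (avgP_dominated PJ').
Qed.

Lemma fwd_cst : fwd (cfun_cst K 1) = cfun_cst L (1 + mu).
Proof.
have P1 : P (cfun_cst K 1) = fun=> cfun_cst L 1.
  by apply/funext => n; rewrite (avgP_cst PJ).
have m1 : (1 + la)^-1 *: middle (cfun_cst K 1) = cfun_cst K 1.
  rewrite /middle P1 (avgJ_cst PJ); apply: cfunP => x; rewrite cfunZE cfunDE cfunZE !cfun_cstE.
  by field; rewrite lt0r_neq0.
rewrite /fwd m1 P1 (_ : scons _ _ = fun=> cfun_cst K 1); last first.
  by apply/funext => -[//|n] /=; rewrite (avgP_cst PJ').
by rewrite (avgJ_cst PJ'); apply: cfunP => x; rewrite cfunDE cfunZE !cfun_cstE; ring.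
Qed.

Lemma bwdK : cancel (bwd (-1)) fwd.
Proof.
move=> g; set f := bwd _ g.
(* Since [P J = 1], the left side at [n] is [P (bwd_mid g) n - la * bwd_seq g n.+1], and the
   recursion for [bwd_seq] turns it into [bwd_seq g n]. *)
have Pf : P f = bwd_seq (-1) g.
  rewrite /f /bwd (avgP_lin PJ) (avgP_J PJ); last exact: (bwd_seq_cauchy normN11).
  apply/funext => n; apply: cfunP => x.
  by rewrite /bwd_seq /= !(cfunDE, cfunZE); field; rewrite lt0r_neq0.
have mf : middle f = bwd_mid (-1) g.
  by rewrite /middle Pf; apply: cfunP => x; rewrite /f /bwd !(cfunDE, cfunZE); ring.
have bP' := avgP_ubounded PJ' g.
rewrite /fwd mf Pf [bwd_seq _ _ _]/=.
have -> : scons ((1 + la)^-1 *: bwd_mid (-1) g) (P' (bwd_fst (-1) g)) = resolvent (-1) mu (P' g).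
  apply/funext => -[|n] /=; first by rewrite scalerA mulVf ?scale1r// lt0r_neq0.
  rewrite /bwd_fst (avgP_lin PJ') (avgP_J PJ'); last exact: (bwd_res_cauchy normN11).
  rewrite mulN1r scaleNr (resolvent_eq normN11 mu1 _ bP') scaleN1r.
  by rewrite opprB subrK.
by apply: cfunP => x; rewrite /bwd_fst !(cfunDE, cfunZE); ring.
Qed.

(** Uniqueness in the two recursions: [e] solves that of the resolvent for [P' g], and [P f] the
    affine one for [P (middle f)]. *)
Lemma fwdK : cancel fwd (bwd (-1)).
Proof.
move=> f; set g := fwd f.
set e := scons ((1 + la)^-1 *: middle f) (P' (P f 0%N)).
have ce : useq_cauchy e by exact: fwd_scons_cauchy.
have Pg : P' g = (fun n => mu *: e n + e n.+1).
  by rewrite /g /fwd (avgP_lin PJ') (avgP_J PJ').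
have re : resolvent (-1) mu (P' g) = e.
  symmetry; apply: (resolvent_uniq normN11 mu1); first exact: (avgP_ubounded PJ').
    have [B BP] := avgP_ubounded PJ' (P f 0%N).
    exists (`|(1 + la)^-1 *: middle f| + `|B|) => -[|n] x /=.
      by apply: le_trans (cfun_norm_ub _ x) _; rewrite lerDl.
    by apply: le_trans (BP n x) _; rewrite ler_wpDl// ler_norm.
  by move=> n; rewrite Pg scaleN1r addrK.
have mg : bwd_mid (-1) g = middle f.
  by rewrite /bwd_mid re /= scalerA mulfV ?scale1r// lt0r_neq0.
have fg : bwd_fst (-1) g = P f 0%N.
  by rewrite /bwd_fst re; apply: cfunP => x; rewrite /g /fwd !(cfunDE, cfunZE); ring.
have sg : bwd_seq (-1) g = P f.
  symmetry; apply: affine_rec_uniq => // n; rewrite mg /middle (avgP_lin PJ).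
  rewrite (avgP_J PJ); last exact: fwd_shift_cauchy.
  by rewrite scaleN1r addrK.
by rewrite /bwd mg sg; apply: cfunP => x; rewrite /middle !(cfunDE, cfunZE); ring.
Qed.

End isomorphism.

(** * From domination to operator bounds *)

Section operator_norms.
Context {R : realType} {K L : compactHausdorffType}.
Implicit Types S : {linear 'C(K, R) -> 'C(L, R)}.

Lemma linear_exists (F : 'C(K, R) -> 'C(L, R)) :
  (forall a f g, F (a *: f + g) = a *: F f + F g) ->
  exists S, forall f, S f = F f.
Proof.
move=> lF; pose m := GRing.isLinear.Build R 'C(K, R) 'C(L, R) *:%R F lF.
by pose S : {linear 'C(K, R) -> 'C(L, R)} := HB.pack F m; exists S.
Qed.

(** As [f] is dominated by the constant [|f|], the value of [F] at 1 controls the norm of [S]. *)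
Lemma dominated_norm_le S (F : 'C(K, R) -> 'C(L, R)) (c : R) : 0 <= c ->
  (forall a f g, F (a *: f + g) = a *: F f + F g) -> F (cfun_cst K 1) = cfun_cst L c ->
  (forall f g, dominated f g -> dominated (S f) (F g)) ->
  forall f, `|S f| <= c * `|f|.
Proof.
move=> c0 lF F1 SF f; apply: cfun_norm_le => [|x]; first by rewrite mulr_ge0.
have := SF _ _ (dominated_norm f) x.
have F0 : F 0 = 0 by rewrite -[0 in LHS](addNr (0 : 'C(K, R))) -scaleN1r lF scaleN1r addNr.
by rewrite -[_ *: _]addr0 lF F1 F0 addr0 cfunZE mulrC.
Qed.

Lemma bounded_op_norm_le S (c : R) : (forall f, `|S f| <= c * `|f|) -> bounded_op S.
Proof.
move=> Sc; apply/linear_boundedP; near=> r => f; apply: le_trans (Sc f) _.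
by rewrite ler_wpM2r//; near: r; apply: nbhs_pinfty_ge; rewrite num_real.
Unshelve. all: end_near. Qed.

Lemma opnorm_le S (c : R) : 0 <= c -> (forall f, `|S f| <= c * `|f|) -> (opnorm S <= c%:E)%E.
Proof.
move=> c0 Sc; apply: ge_ereal_sup => _ [f /= f1 <-]; rewrite lee_fin.
by apply: le_trans (Sc f) _; rewrite ler_piMr.
Qed.

Lemma dominated_positive (F : 'C(K, R) -> 'C(L, R)) :
  (forall f g, dominated f g -> dominated (F f) (F g)) -> positive_op F.
Proof. by move=> FF f f0; apply/dominated_ge0/FF/dominated_refl. Qed.

End operator_norms.

(** * Choice of the parameters and conclusion *)

Theorem theorem1p1 (R : realType) (K L : compactHausdorffType)
    (metK : metrizable R K) (metL : metrizable R L)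
    (uncK : ~ countable [set: K]) (uncL : ~ countable [set: L]) :
  exists (T : {linear 'C(K, R) -> 'C(L, R)})
         (Tinv : {linear 'C(L, R) -> 'C(K, R)}),
    [/\ positive_isomorphism_with_inverse T Tinv,
        regular_op Tinv,
        (opnorm T <= (Num.sqrt (9 + 6 * Num.sqrt 3))%:E)%E &
        (regular_norm Tinv <= (Num.sqrt (9 + 6 * Num.sqrt 3))%:E)%E].

Proof.
have [k0 _] : [set: K] !=set0.
  by apply/set0P/eqP => K0; apply: uncK; rewrite K0; exact: countable0.
have [l0 _] : [set: L] !=set0.
  by apply/set0P/eqP => L0; apply: uncL; rewrite L0; exact: countable0.
have [P [J PJ]] := averaging_pair_exists metK metL uncK (ex_intro _ l0 I).
have [P' [J' PJ']] := averaging_pair_exists metL metK uncL (ex_intro _ k0 I).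
set r3 : R := Num.sqrt 3; set C : R := Num.sqrt _.
have r30 : 0 < r3 by rewrite sqrtr_gt0.
have r3E : r3 ^+ 2 = 3 by rewrite sqr_sqrtr.
have C0 : 0 < C by rewrite sqrtr_gt0; lra.
have CE : C ^+ 2 = 9 + 6 * r3 by rewrite sqr_sqrtr//; lra.
(* The minimum of [(2 mu - 1) (mu + 1)^2 / (mu - 1)^2] over [mu > 1] is reached here;
   [th] makes the two norms equal. *)
pose mu := 2 + r3.
have mu1 : 1 < mu by rewrite /mu; lra.
have mu2 : 0 < 1 + mu by lra.
pose T0 := fwd P J P' J' mu; pose B s := bwd P J P' J' mu s.
pose th := C / (1 + mu).
have th0 : 0 < th by rewrite divr_gt0.
have thV0 : 0 < th^-1 by rewrite invr_gt0.
have s1 : `|1 : R| <= 1 by rewrite normr1.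
have sN1 : `|-1 : R| <= 1 by rewrite normrN normr1.
have scal (U V : lmodType R) (F : U -> V) (t : R) :
    (forall a f g, F (a *: f + g) = a *: F f + F g) ->
    forall a f g, t *: F (a *: f + g) = a *: (t *: F f) + t *: F g.
  by move=> lF a f g; rewrite lF scalerDr !scalerA mulrC.
have lT := scal _ _ _ th (fwd_linear PJ PJ' mu).
have lB s (hs : `|s| <= 1) := scal _ _ _ th^-1 (bwd_linear PJ PJ' mu1 hs).
have [T TE] := linear_exists lT.
have [S SE] := linear_exists (lB _ sN1).
have [Q QE] := linear_exists (lB _ s1).
have scaled (X Y : compactHausdorffType) (t : R) (F G : 'C(X, R) -> 'C(Y, R)) : 0 < t ->
    (forall f g, dominated f g -> dominated (F f) (G g)) ->
    forall f g, dominated f g -> dominated (t *: F f) (t *: G g).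
  move=> t0 FG f g /FG fg x; rewrite !cfunZE normrM gtr0_norm// ler_wpM2l//; exact: ltW.
have dT f g : dominated f g -> dominated (T f) (th *: T0 g).
  by rewrite TE; apply: scaled => //; exact: (fwd_dominated PJ PJ' mu1).
have dQ f g : dominated f g -> dominated (Q f) (th^-1 *: B 1 g).
  by rewrite QE; apply: scaled => // *; exact: (bwd_dominated PJ PJ').
have dS f g : dominated f g -> dominated (S f) (th^-1 *: B 1 g).
  by rewrite SE; apply: scaled => // *; exact: (bwd_dominated PJ PJ').
have T1 : th *: T0 (cfun_cst K 1) = cfun_cst L C.
  rewrite /T0 (fwd_cst PJ PJ' mu1); apply: cfunP => x; rewrite cfunZE /=.
  by rewrite mulfVK// lt0r_neq0.
have B1 : th^-1 *: B 1 (cfun_cst L 1) = cfun_cst K C.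
  rewrite /B (bwd1_cst PJ PJ' mu1); apply: cfunP => x; rewrite cfunZE /= /th invf_div.
  have -> : (1 + mu) / C * ((2 * mu - 1) * (mu + 1) / (mu - 1) ^+ 2) =
      (1 + mu) ^+ 2 * (2 * mu - 1) / (mu - 1) ^+ 2 / C.
    by field; rewrite !lt0r_neq0// subr_gt0.
  (* Cleared of denominators, the claim is [(1 + mu)^2 (2 mu - 1) = C^2 (mu - 1)^2]; the difference
     of its sides is a polynomial in [r3] divisible by [r3^2 - 3]. *)
  apply: (mulIf (lt0r_neq0 C0)); rewrite mulfVK ?lt0r_neq0// -expr2 CE.
  have m0 : (mu - 1) ^+ 2 != 0 by rewrite lt0r_neq0// exprn_gt0// subr_gt0.
  apply: (mulIf m0); rewrite mulfVK// /mu.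
  apply/eqP; rewrite -subr_eq0; apply/eqP.
  rewrite [LHS](_ : _ = - (4 * r3 + 6) * (r3 ^+ 2 - 3)); last by ring.
  by rewrite r3E subrr mulr0.
have nT := dominated_norm_le (ltW C0) lT T1 dT.
have nQ := dominated_norm_le (ltW C0) (lB _ s1) B1 dQ.
have nS := dominated_norm_le (ltW C0) (lB _ s1) B1 dS.
have pT : positive_op T.
  by apply: dominated_positive => f g; rewrite TE => fg; rewrite TE -TE; exact: dT.
have pQ : positive_op Q by apply: dominated_positive => f g /dQ; rewrite !QE.
have QS f x : 0 <= f -> `|S f x| <= Q f x.
  by move=> /dominated_refl/dS; rewrite QE; exact.
have bQ := bounded_op_norm_le nQ.
have thK (V : lmodType R) (v : V) : th^-1 *: (th *: v) = v.
  by rewrite scalerA mulVf ?scale1r// lt0r_neq0.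
have TS : cancel S T by move=> g; rewrite SE linearZ/= TE thK; exact: (bwdK PJ PJ' mu1).
have ST : cancel T S.
  move=> f; rewrite TE linearZ/= SE scalerA mulfV ?scale1r; last by rewrite lt0r_neq0.
  exact: (fwdK PJ PJ' mu1).
exists T, S; split.
- by split=> //; split=> //; [exact: bounded_op_norm_le nT|exact: bounded_op_norm_le nS].
(* [S = Q - (Q - S)], and both terms are positive because [Q] dominates [S]. *)
- have lD a f g : Q (a *: f + g) - S (a *: f + g) = a *: (Q f - S f) + (Q g - S g).
    by rewrite !linearP addrACA -scalerDr.
  have [D DE] := linear_exists lD.
  exists Q, D; split => //.
  + apply: (@bounded_op_norm_le _ _ _ _ (C + C)) => f; rewrite DE mulrDl.
    by apply: le_trans (ler_normB _ _) _; exact: lerD.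
  + move=> f f0; rewrite DE; apply/cfun_leP => x; rewrite cfunDE cfunNE subr_ge0.
    exact: le_trans (ler_norm _) (QS _ _ f0).
  + by move=> f; rewrite DE opprB addrC subrK.
- exact: opnorm_le (ltW C0) nT.
apply: le_trans (opnorm_le (ltW C0) nQ); apply: ereal_inf_lbound; exists Q => //.
split=> // f f0; apply/cfun_leP => x; have /ler_normlP[h1 h2] := QS _ x f0;
  rewrite cfunDE cfunNE ?cfunNE cfun0E; lra.
Qed.
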